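(* Let $(X,d,A)$ be a metric pair with $A\neq\varnothing$ such that $(X/A,\overline d_1,[A])$ is uniformly discrete, let $\psi:[0,\infty)\to[0,\infty)$ satisfy $\psi(0)=0$ and $\sum_{x,y\in X\setminus A,\,x\ne y}\psi(\overline d_1(x,y))<\infty$, and let $H$, $\lambda_H$, $\mathcal E_H$, $G_s(0,0)$ be as in the context. For every $s>0$ and every $f\in\ell^2(H)$ with finite Dirichlet energy $\mathcal E_H(f,f)$, $$\|f\|_\infty^2\le G_s(0,0)\,\bigl(s\,\|f\|_2^2+\mathcal E_H(f,f)\bigr).$$ The constant $G_s(0,0)$ is optimal, i.e. for each $s>0$ it is the smallest constant for which this inequality holds for all such $f$.
   Context: Metric pair: $(X,d)$ is a metric space and $A\subseteq X$ is nonempty. Put $d(x,A)=\inf_{a\in A}d(x,a)$ and $d_1(x,y)=\min(d(x,y),d(x,A)+d(y,A))$. $X/A$ is the quotient collapsing $A$ to a basepoint $[A]$, and $\overline d_1$ is the metric on $X/A$ induced by $d_1$ (so $\overline d_1(x,y)=d_1(x,y)$ and $\overline d_1(x,[A])=d(x,A)$ for $x,y\in X\setminus A$). Uniformly discrete means: there is $c>0$ with $\overline d_1(u,v)\ge c$ for all distinct $u,v\in X/A$. $D(X,A)$ is the free commutative monoid on $X$ modulo the submonoid generated by $A$; $K(X,A)$ is its Grothendieck group, identified with $\bigoplus_{x\in X\setminus A}\mathbb Z e_x$ and regarded as a discrete abelian group. For a discrete abelian group $G$, $\widehat G$ is the compact group of characters $G\to\mathbb T$; $\widehat p(\theta)=\sum_gp(g)\overline{\theta(g)}$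 (extended to $\ell^2(G)$ by Plancherel). For $\theta\in\widehat{K(X,A)}$ put $\lambda^\psi(\theta)=\frac12\sum_{x,y\in X\setminus A,\,x\neq y}\psi(\overline d_1(x,y))(1-\Re\,\theta(e_x-e_y))$; $(p_t)_{t\ge0}$ is the unique convolution semigroup of probability measures on $K(X,A)$ with $\widehat{p_t}=e^{-t\lambda^\psi}$. With $\operatorname{supp}(p)=\{g:p(g)>0\}$, $H$ is the subgroup generated by $\bigcup_{q\in\mathbb Q_{\ge0}}\operatorname{supp}(p_q)$; it is countable and contains every $\operatorname{supp}(p_t)$. $\lambda_H:\widehat H\to[0,\infty)$ is the function with $\sum_{h\in H}p_t(h)\overline{\theta(h)}=e^{-t\lambda_H(\theta)}$ for all $t\ge0$; $\mu_{\widehat H}$ is normalized Haar measure on $\widehat H$. The Dirichlet form is $\mathcal E_H(f,g)=\int_{\widehat H}\lambda_H\,\widehat f\,\overline{\widehat g}\,d\mu_{\widehat H}$ on $\mathcal D(\mathcal E_H)=\{f\in\ell^2(H):\int_{\widehat H}\lambda_H|\widehat f|^2d\mu_{\widehat H}<\infty\}$. $L$ is the associated nonnegative self-adjoint operator on $\ell^2(H)$ ($\widehat{Lf}=\lambda_H\widehat f$, so that convolution by $p_t$ on $\ell^2(H)$ is $e^{-tL}$), and $G_s(0,0)=\langle\delta_0,(s+L)^{-1}\delta_0\rangle_{\ell^2(H)}$ for $s>0$. *)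

(* Defs.v *)
From HB Require Import structures.
From mathcomp Require Import all_boot all_order all_algebra.
From mathcomp Require Import generic_quotient finmap.
From mathcomp Require Import complex.
From mathcomp Require Import all_classical all_reals all_analysis.
From mathcomp Require Import freeg.

Set Implicit Arguments.
Unset Strict Implicit.
Unset Printing Implicit Defensive.

Import Order.TTheory GRing.Theory Num.Theory.
Import numFieldNormedType.Exports.

Local Open Scope classical_set_scope.
Local Open Scope ring_scope.
Local Open Scope complex_scope.
Local Open Scope quotient_scope.

Section MetricPair.
Context {R : realType} {X : metricType R}.
Implicit Types (A : set X) (x y : X).

Definition set_dist A x : R := inf [set mdist x a | a in A].

Definition d1 A x y : R :=
  Num.min (mdist x y) (set_dist A x + set_dist A y).

Definition collapse_rel A : rel X :=
  fun x y => (x == y) || (x \in A) && (y \in A).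

Lemma collapse_rel_refl A : reflexive (collapse_rel A).
Proof. by move=> x; rewrite /collapse_rel eqxx. Qed.

Lemma collapse_rel_sym A : symmetric (collapse_rel A).
Proof. by move=> x y; rewrite /collapse_rel eq_sym andbC. Qed.

Lemma collapse_rel_trans A : transitive (collapse_rel A).
Proof.
move=> y x z; rewrite /collapse_rel => /orP[/eqP->//|/andP[xA yA]].
by move=> /orP[/eqP<-|/andP[_ zA]]; rewrite xA ?yA ?zA orbT.
Qed.

Canonical collapse_equiv A := EquivRel (collapse_rel A)
  (collapse_rel_refl A) (@collapse_rel_sym A) (@collapse_rel_trans A).

Definition collapse A := {eq_quot collapse_equiv A}.

(* Independent of the representatives, see d1bar_pi and d1bar_pi_base. *)
Definition d1bar A (u v : collapse A) : R := d1 A (repr u) (repr v).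

Definition uniformly_discrete A : Prop :=
  exists2 c : R, 0 < c & forall u v : collapse A, u <> v -> c <= d1bar u v.

Lemma set_dist_ge0 A x : 0 <= set_dist A x.
Proof.
rewrite /set_dist; have [[a Aa]|A0] := pselect (A !=set0).
  apply: lb_le_inf; first by exists (mdist x a), a.
  by move=> _ [b _ <-]; exact: mdist_ge0.
by move/set0P/negP/negPn/eqP: A0 => ->; rewrite image_set0 inf0.
Qed.

Lemma set_dist_le A x a : A a -> set_dist A x <= mdist x a.
Proof.
move=> Aa; apply: ge_inf; last by exists a.
by exists 0 => _ [b _ <-]; exact: mdist_ge0.
Qed.

Lemma set_dist_eq0 A a : A a -> set_dist A a = 0.
Proof.
move=> Aa; apply/eqP; rewrite eq_le set_dist_ge0 andbT.
by rewrite -(mdistxx a); exact: set_dist_le.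
Qed.

Lemma d1_sym A x y : d1 A x y = d1 A y x.
Proof. by rewrite /d1 metric_sym addrC. Qed.

Lemma d1_set_dist A x a : A a -> d1 A x a = set_dist A x.
Proof.
by move=> Aa; rewrite /d1 (set_dist_eq0 Aa) addr0; apply/min_idPr/set_dist_le.
Qed.

Lemma d1_collapse A x x' y : collapse_rel A x x' -> d1 A x y = d1 A x' y.
Proof.
move=> /orP[/eqP->//|/andP[/set_mem Ax /set_mem Ax']].
by rewrite ![d1 A _ y]d1_sym !d1_set_dist.
Qed.

Lemma collapse_rel_repr A x : collapse_rel A (repr (\pi_(collapse A) x)) x.
Proof.
have /eqmodP : repr (\pi_(collapse A) x) = x %[mod collapse A] by rewrite reprK.
by [].
Qed.

Lemma d1bar_pi A x y :
  d1bar (\pi_(collapse A) x) (\pi_(collapse A) y) = d1 A x y.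
Proof.
rewrite /d1bar (d1_collapse _ (collapse_rel_repr A x)) d1_sym.
by rewrite (d1_collapse _ (collapse_rel_repr A y)) d1_sym.
Qed.

Lemma d1bar_pi_base A x a : A a ->
  d1bar (\pi_(collapse A) x) (\pi_(collapse A) a) = set_dist A x.
Proof. by move=> Aa; rewrite d1bar_pi d1_set_dist. Qed.

Definition off A : choiceType := set_type (~` A).

(* K(X, A), the Grothendieck group of the free commutative monoid on X modulo *)
(* A, is free abelian on X \ A.                                               *)
Definition KXA A : zmodType := {freeg (off A)}.

Definition gen_e A (x : off A) : KXA A := << x >>.

Definition off_d1bar A (x y : off A) : R :=
  d1bar (\pi_(collapse A) (val x)) (\pi_(collapse A) (val y)).

Definition off_pairs A : set (off A * off A) := [set xy | xy.1 != xy.2].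

End MetricPair.

Section GeneratedSubgroup.
Context {G : zmodType}.

Definition is_subgroup (S : set G) : Prop :=
  S 0 /\ forall g h, S g -> S h -> S (g - h).

Definition gen_subgroup (B : set G) : set G := smallest is_subgroup B.

Definition gen_subgroup_pred (B : set G) : {pred G} :=
  fun g => `[< gen_subgroup B g >].

Lemma gen_subgroup_closed (B : set G) : zmod_closed (gen_subgroup_pred B).
Proof.
split=> [|g h /asboolP Bg /asboolP Bh]; apply/asboolP => S SB.
  by case: SB => -[].
by have [[_ subS] _] := SB; apply: subS; [exact: Bg|exact: Bh].
Qed.

HB.instance Definition _ (B : set G) :=
  GRing.isZmodClosed.Build G (gen_subgroup_pred B) (gen_subgroup_closed B).

Definition gen_group (B : set G) : Type := {g : G | gen_subgroup_pred B g}.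

HB.instance Definition _ (B : set G) := SubChoice.on (gen_group B).
HB.instance Definition _ (B : set G) :=
  [SubChoice_isSubZmodule of gen_group B by <:].

End GeneratedSubgroup.

Section Dual.
Context {R : realType} {G : zmodType}.

(* Characters of the discrete group G. The dual carries the topology of       *)
(* pointwise convergence, which for discrete G is the compact-open topology.  *)
Definition characters : set {ptws G -> R[i]^o} :=
  [set th | (forall g, `|th g : R[i]| = 1) /\
            (forall g h, th (g + h) = (th g : R[i]) * th h)].

Definition dual : topologicalType := set_type characters.

Definition ev (th : dual) (g : G) : R[i] := val th g.

Lemma trivial_characterP : characters (fun=> 1).
Proof. by split=> [g|g h]; rewrite ?normr1 ?mulr1. Qed.

Definition trivial_character : dual :=
  exist (fun th => th \in characters) _ (mem_set trivial_characterP).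

Lemma evP (th : dual) :
  (forall g, `|ev th g| = 1) /\ (forall g h, ev th (g + h) = ev th g * ev th h).
Proof. exact: set_mem (valP th). Qed.

Lemma mul_characterP (th th' : dual) : characters (fun g => ev th g * ev th' g).
Proof.
have [[n1 m1] [n2 m2]] := (evP th, evP th').
by split=> [g|g h]; rewrite ?normrM ?n1 ?n2 ?mulr1// m1 m2 mulrACA.
Qed.

Definition mul_character (th th' : dual) : dual :=
  exist (fun th => th \in characters) _ (mem_set (mul_characterP th th')).

End Dual.
Arguments dual : clear implicits.

HB.instance Definition _ (R : realType) (G : zmodType) :=
  isPointed.Build (dual R G) trivial_character.

Definition borel_dual (R : realType) (G : zmodType) :=
  g_sigma_algebraType (@open (dual R G)).

(* mu has total mass 1 as a probability; no regularity is required, since it  *)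
(* is automatic for a Borel probability on the compact metrizable dual of a   *)
(* countable group.                                                           *)
Definition is_normalized_haar (R : realType) (G : zmodType)
    (mu : probability (borel_dual R G) R) : Prop :=
  forall (th : dual R G) (B : set (borel_dual R G)),
    measurable B -> mu (mul_character th @` B) = mu B.

Section Summation.
Context {R : realType} {I : choiceType}.

(* Unconditional sums over an arbitrary index set; only meaningful for        *)
(* absolutely summable families.                                              *)
Definition rsum (f : I -> R) : R :=
  fine (esum setT (EFin \o f)^\+ - esum setT (EFin \o f)^\-)%E.

Definition csum (f : I -> R[i]) : R[i] :=
  rsum (fun i => complex.Re (f i)) +i* rsum (fun i => complex.Im (f i)).

End Summation.

Section ConvolutionSemigroup.
Context {R : realType} {G : zmodType}.
Implicit Types (p q : G -> R).

Definition is_prob p : Prop :=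
  (forall g, 0 <= p g) /\ (\esum_(g in setT) (p g)%:E = 1)%E.

Definition supp p : set G := [set g | 0 < p g].

Definition conv p q (g : G) : R := rsum (fun h => p h * q (g - h)).

(* Only the times t >= 0 matter. Weak continuity in t is not required: it is  *)
(* implied when the transform of p t is expR (- (t * lambda)).                *)
Definition convolution_semigroup (p : R -> G -> R) : Prop :=
  [/\ forall t, 0 <= t -> is_prob (p t),
      forall g, p 0 g = (g == 0)%:R &
      forall t t', 0 <= t -> 0 <= t' -> p (t + t') = conv (p t) (p t')].

Definition fourier1 (f : G -> R[i]) (th : dual R G) : R[i] :=
  csum (fun g => f g * (ev th g)^*).

Definition support_group (p : R -> G -> R) : zmodType :=
  gen_group (\bigcup_(q in [set q : rat | 0 <= q]) supp (p (ratr q))).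

Definition support_group_val (p : R -> G -> R) (h : support_group p) : G :=
  sval h.

End ConvolutionSemigroup.

Section LambdaPsi.
Context {R : realType} {X : metricType R} (A : set X) (psi : R -> R).

Definition lambda_psi (th : dual R (KXA A)) : R :=
  2^-1 * fine (\esum_(xy in @off_pairs R X A)
    (psi (off_d1bar xy.1 xy.2) *
       (1 - complex.Re (ev th (gen_e xy.1 - gen_e xy.2))))%:E)%E.

End LambdaPsi.

Section L2.
Context {R : realType} {G : zmodType}.
Implicit Types (f g : G -> R[i]).

Definition ell2 f : Prop :=
  (\esum_(h in setT) ((Normc.normc (f h)) ^+ 2)%:E < +oo)%E.

Definition ell2_norm f : R :=
  Num.sqrt (fine (\esum_(h in setT) ((Normc.normc (f h)) ^+ 2)%:E)%E).

Definition sup_norm f : R := sup [set Normc.normc (f h) | h in setT].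

Definition ell2_inner f g : R[i] := csum (fun h => f h * (g h)^*).

Definition delta0 (h : G) : R[i] := (h == 0)%:R.

Context (mu : probability (borel_dual R G) R).
Implicit Types (F : borel_dual R G -> R[i]).

Definition cmeasurable F : Prop :=
  measurable_fun setT (fun th => complex.Re (F th)) /\
  measurable_fun setT (fun th => complex.Im (F th)).

Definition cintegral F : R[i] :=
  Rintegral mu setT (fun th => complex.Re (F th)) +i*
  Rintegral mu setT (fun th => complex.Im (F th)).

(* F is a version of the Plancherel transform of f, i.e. the L^2-limit of the *)
(* transforms of the restrictions of f to finite sets.                        *)
Definition is_plancherel f F : Prop :=
  cmeasurable F /\
  forall e : R, 0 < e -> exists S0 : {fset G}, forall S : {fset G},
    (S0 `<=` S)%fset ->
    (\int[mu]_(th in setT)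
       ((Normc.normc (F th - \sum_(h <- S) f h * (ev th h)^*)) ^+ 2)%:E
     < e%:E)%E.

(* Well defined up to mu-null sets; the default value is never reached on     *)
(* ell2 when mu is the Haar measure.                                          *)
Definition plancherel f : borel_dual R G -> R[i] :=
  xget (fun=> 0) (is_plancherel f).

Context (lam : dual R G -> R).

Definition dirichlet_domain f : Prop :=
  ell2 f /\
  (\int[mu]_(th in setT)
     (lam th * (Normc.normc (plancherel f th)) ^+ 2)%:E < +oo)%E.

Definition dirichlet_form f g : R[i] :=
  cintegral (fun th => (lam th)%:C * plancherel f th * (plancherel g th)^*).

(* L f = g. The generator L is given by its graph, which determines its       *)
(* domain {f in ell2 | lam * plancherel f in L^2(mu)}.                        *)
Definition generator_graph f g : Prop :=
  [/\ ell2 f, ell2 g &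
      {ae mu, forall th, plancherel g th = (lam th)%:C * plancherel f th}].

(* (s + L)^-1 g *)
Definition resolvent (s : R) g : G -> R[i] :=
  xget (fun=> 0)
    [set f | exists2 v, generator_graph f v & forall h, s%:C * f h + v h = g h].

Definition green (s : R) : R[i] := ell2_inner delta0 (resolvent s delta0).

End L2.

(* Main.v *)
Require Import Defs.
From HB Require Import structures.
From mathcomp Require Import all_boot all_order all_algebra.
From mathcomp Require Import generic_quotient finmap.
From mathcomp Require Import complex.
From mathcomp Require Import all_classical all_reals all_analysis.
From mathcomp Require Import measurable_realfun.
From mathcomp Require Import freeg.
From mathcomp Require Import ring lra.

Set Implicit Arguments.
Unset Strict Implicit.
Unset Printing Implicit Defensive.

Import Order.TTheory GRing.Theory Num.Theory.
Import numFieldNormedType.Exports.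

Local Open Scope classical_set_scope.
Local Open Scope ring_scope.
Local Open Scope complex_scope.

(* Under the Plancherel transform [(s + L)^-1] becomes multiplication by        *)
(* [(s + lam)^-1], so that [G_s(0,0) = \int (s + lam)^-1]. Writing [fh] for the  *)
(* transform of [f], the inequality is the Cauchy-Schwarz inequality for        *)
(* [f h = \int (sqrt (s + lam) fh th) (ev th h / sqrt (s + lam))],               *)
(* and [f = (s + L)^-1 delta_0] is an equality case.                            *)
(*                                                                              *)
(* That [(s + lam)^-1] is a transform does not need the surjectivity of the     *)
(* Plancherel transform: it is the Laplace transform of [t |-> exp (- t lam)],  *)
(* its Riemann sums converge uniformly in [lam >= 0], and each [exp (- t lam)]  *)
(* is the absolutely convergent Fourier series of [p t]. The characters are     *)
(* orthogonal because the dual separates points: [KXA] is free abelian.         *)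
(* Riesz-Fischer completeness is needed because [plancherel f] has a junk value *)
(* unless the L^2 limit exists.                                                 *)

(** Let W = sqrt (s + lam) * fh with fh the transform of f ([weighted_transform]). Parseval turns s
    ||f||^2 + E(f, f) into ||W||^2 ([dirichlet_energy]), and Fourier inversion ([coef_plancherel])
    makes f h the inner product of W with [weighted_character h], whose squared norm is the integral
    of 1 / (s + lam), whatever h is. [L2_Cauchy_Schwarz] thus bounds every |f h|^2 by one and the
    same quantity, hence also the supremum ([sqr_sup_norm_le]). [resolvent_delta0] and [green_eq]
    recognise the integral of 1 / (s + lam) as the Green function at 0.

    Optimality is tested on g = (s + L)^-1 delta_0: its value at 0 and its energy both equal G =
    G_s(0,0) ([green_function0], [green_extremal]), so an admissible constant C satisfies G^2 <= C
    G, and G > 0 can be cancelled.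

    For lam >= 0 and a Haar probability on the dual, the argument rests on two facts. Characters
    separate points, which makes them orthonormal ([cintegral_ev]). Each exp (- t lam) is a uniform
    limit of trigonometric polynomials, hence so is 1 / (s + lam) ([uniform_trig_resolvent_symbol]).
    For H these facts come from [separating_character] and [uniform_trig_fourier1]. *)

Local Notation n2 z := (Normc.normc z ^+ 2).

(** * The squared modulus of a complex number *)

Section ComplexNorm.
Context {R : rcfType}.
Implicit Types (z w : R[i]).

Lemma sqr_normcE z : n2 z = complex.Re z ^+ 2 + complex.Im z ^+ 2.
Proof. by case: z => a b; rewrite sqr_sqrtr// addr_ge0// sqr_ge0. Qed.

Lemma sqr_normc_ge0 z : 0 <= n2 z.
Proof. exact: sqr_ge0. Qed.

Lemma mul_conjcE z : z * z^* = (n2 z)%:C.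
Proof.
rewrite sqr_normcE; case: z => a b; apply/eqP; rewrite eq_complex /=.
by apply/andP; split; apply/eqP; ring.
Qed.

Lemma sqr_normcD_le z w : n2 (z + w) <= 2 * n2 z + 2 * n2 w.
Proof.
rewrite !sqr_normcE; case: z w => [a b] [c d] /=.
have := sqr_ge0 (a - c); have := sqr_ge0 (b - d); rewrite !expr2; nra.
Qed.

Lemma sqr_normcB z w :
  n2 (z - w) = n2 z - 2 * complex.Re (z * w^*) + n2 w.
Proof. by rewrite !sqr_normcE; case: z w => [a b] [c d] /=; ring. Qed.

Lemma sqr_normcM z w : n2 (z * w) = n2 z * n2 w.
Proof. by rewrite Normc.normcM exprMn. Qed.

Lemma sqr_normcN z : n2 (- z) = n2 z.
Proof. by rewrite !sqr_normcE; case: z => [a b] /=; ring. Qed.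

Lemma sqr_normc_conj z : n2 (z^*) = n2 z.
Proof. by rewrite !sqr_normcE; case: z => [a b] /=; ring. Qed.

(* In complex_scope [_^*] is [conjc], whereas arguments of ring operations are  *)
(* parsed in ring_scope, where it is [Num.conj]; the two are convertible.       *)
Lemma conj_realM (a : R) z : ((a%:C * z^*)^*)%R = a%:C * z.
Proof.
case: z => x y; apply/eqP; rewrite eq_complex /=.
by apply/andP; split; apply/eqP; ring.
Qed.

Lemma normr_Re_le z : `|complex.Re z| <= Normc.normc z.
Proof.
case: z => x y /=; rewrite -sqrtr_sqr.
by rewrite ler_sqrt ?lerDl ?sqr_ge0// addr_ge0 ?sqr_ge0.
Qed.

Lemma normr_Im_le z : `|complex.Im z| <= Normc.normc z.
Proof.
case: z => x y /=; rewrite -sqrtr_sqr.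
by rewrite ler_sqrt ?lerDr ?sqr_ge0// addr_ge0 ?sqr_ge0.
Qed.

Lemma normc_ge0 z : 0 <= Normc.normc z.
Proof. by case: z => a b; exact: sqrtr_ge0. Qed.

Lemma normc_le_ReIm z :
  Normc.normc z <= `|complex.Re z| + `|complex.Im z|.
Proof.
case: z => a b /=; rewrite -[leRHS]ger0_norm ?addr_ge0//.
rewrite -(sqrtr_sqr (`|a| + `|b|)) ler_sqrt ?sqr_ge0//.
rewrite -(real_normK (num_real a)) -(real_normK (num_real b)).
by have := normr_ge0 a; have := normr_ge0 b; rewrite !expr2; nra.
Qed.

End ComplexNorm.

(** * Square-integrable complex functions *)

Section ComplexIntegral.
Context {R : realType} {G : zmodType} (mu : probability (borel_dual R G) R).
Local Notation T := (borel_dual R G).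
Implicit Types (F H : T -> R[i]) (z : R[i]).

Lemma cmeasurable_cst z : cmeasurable (fun _ : T => z).
Proof. by split; exact: measurable_cst. Qed.

Lemma cmeasurableD F H : cmeasurable F -> cmeasurable H ->
  cmeasurable (fun th => F th + H th).
Proof.
move=> [F1 F2] [H1 H2]; split.
- rewrite (_ : (fun _ => _) = (fun th => complex.Re (F th) + complex.Re (H th))).
    exact: measurable_funD.
  by apply/funext => th; case: (F th) (H th) => [a b] [c d].
- rewrite (_ : (fun _ => _) = (fun th => complex.Im (F th) + complex.Im (H th))).
    exact: measurable_funD.
  by apply/funext => th; case: (F th) (H th) => [a b] [c d].
Qed.

Lemma cmeasurableM F H : cmeasurable F -> cmeasurable H ->
  cmeasurable (fun th => F th * H th).
Proof.
move=> [F1 F2] [H1 H2]; split.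
- rewrite (_ : (fun _ => _) = (fun th => complex.Re (F th) * complex.Re (H th)
    - complex.Im (F th) * complex.Im (H th))).
    by apply: measurable_funB; exact: measurable_funM.
  by apply/funext => th; case: (F th) (H th) => [a b] [c d].
- rewrite (_ : (fun _ => _) = (fun th => complex.Re (F th) * complex.Im (H th)
    + complex.Im (F th) * complex.Re (H th))).
    by apply: measurable_funD; exact: measurable_funM.
  by apply/funext => th; case: (F th) (H th) => [a b] [c d].
Qed.

Lemma cmeasurable_conj F : cmeasurable F -> cmeasurable (fun th => (F th)^*).
Proof.
move=> [F1 F2]; split.
- rewrite (_ : (fun _ => _) = (fun th => complex.Re (F th)))//.
  by apply/funext => th; case: (F th) => [a b].
- rewrite (_ : (fun _ => _) = (fun th => - complex.Im (F th))).
    exact: measurableT_comp.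
  by apply/funext => th; case: (F th) => [a b].
Qed.

Lemma cmeasurableB F H : cmeasurable F -> cmeasurable H ->
  cmeasurable (fun th => F th - H th).
Proof.
move=> mF mH; rewrite (_ : (fun _ => _) = (fun th => F th + (-1) * H th)).
  by apply: cmeasurableD => //; apply: cmeasurableM => //; exact: cmeasurable_cst.
by apply/funext => th; rewrite mulN1r.
Qed.

Lemma cmeasurable_sum I (s : seq I) (F : I -> T -> R[i]) :
  (forall i, cmeasurable (F i)) ->
  cmeasurable (fun th => \sum_(i <- s) F i th).
Proof.
move=> mF; elim: s => [|i s ih].
  by under eq_fun do rewrite big_nil; exact: cmeasurable_cst.
by under eq_fun do rewrite big_cons; exact: cmeasurableD.
Qed.

Lemma cmeasurable_real (f : T -> R) :
  measurable_fun setT f -> cmeasurable (fun th => (f th)%:C).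
Proof. by move=> mf; split=> //=; exact: measurable_cst. Qed.

Lemma measurable_sqr_normc F : cmeasurable F ->
  measurable_fun setT (fun th => n2 (F th)).
Proof.
move=> [F1 F2]; under eq_fun do rewrite sqr_normcE.
by apply: measurable_funD; exact: measurable_funX.
Qed.

Definition cintegrable F :=
  mu.-integrable setT (fun th => (complex.Re (F th))%:E) /\
  mu.-integrable setT (fun th => (complex.Im (F th))%:E).

Lemma cintegrableD F H : cintegrable F -> cintegrable H ->
  cintegrable (fun th => F th + H th).
Proof.
move=> [F1 F2] [H1 H2]; split.
- apply: eq_integrable (integrableD _ F1 H1) => // th _ /=.
  by case: (F th) (H th) => [a b] [c d].
- apply: eq_integrable (integrableD _ F2 H2) => // th _ /=.
  by case: (F th) (H th) => [a b] [c d].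
Qed.

Lemma cintegralD F H : cintegrable F -> cintegrable H ->
  cintegral mu (fun th => F th + H th) = cintegral mu F + cintegral mu H.
Proof.
move=> [F1 F2] [H1 H2]; rewrite /cintegral /=; apply/eqP; rewrite eq_complex /=.
rewrite -!RintegralD//; apply/andP; split; apply/eqP/eq_Rintegral => th _.
  by case: (F th) (H th) => [a b] [c d].
by case: (F th) (H th) => [a b] [c d].
Qed.

Lemma integrable_lin (a b : R) (f g : T -> R) :
  mu.-integrable setT (EFin \o f) -> mu.-integrable setT (EFin \o g) ->
  mu.-integrable setT (EFin \o (fun th => a * f th + b * g th)).
Proof.
move=> fi gi.
by apply: eq_integrable (integrableD _ (integrableZl _ a fi) (integrableZl _ b gi)).
Qed.

Lemma Rintegral_lin (a b : R) (f g : T -> R) :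
  mu.-integrable setT (EFin \o f) -> mu.-integrable setT (EFin \o g) ->
  \int[mu]_(th in setT) (a * f th + b * g th) =
  a * (\int[mu]_(th in setT) f th) + b * (\int[mu]_(th in setT) g th).
Proof.
move=> fi gi; rewrite RintegralD//; first by rewrite !RintegralZl.
- by apply: eq_integrable (integrableZl _ a fi).
- by apply: eq_integrable (integrableZl _ b gi).
Qed.

Lemma cintegrableZ z F : cintegrable F -> cintegrable (fun th => z * F th).
Proof.
case: z => a b [F1 F2]; split.
- apply: eq_integrable (integrable_lin a (- b) F1 F2) => // th _ /=.
  by case: (F th) => [c d] /=; rewrite mulNr.
- apply: eq_integrable (integrable_lin a b F2 F1) => // th _ /=.
  by case: (F th) => [c d].
Qed.

Lemma cintegralZ z F : cintegrable F ->
  cintegral mu (fun th => z * F th) = z * cintegral mu F.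
Proof.
case: z => a b [F1 F2]; rewrite /cintegral /=; apply/eqP; rewrite eq_complex /=.
rewrite -mulNr -!Rintegral_lin//; apply/andP; split; apply/eqP/eq_Rintegral => th _.
  by case: (F th) => [c d] /=; rewrite mulNr.
by case: (F th) => [c d] /=.
Qed.

Lemma cintegralB F H : cintegrable F -> cintegrable H ->
  cintegral mu (fun th => F th - H th) = cintegral mu F - cintegral mu H.
Proof.
move=> iF iH; rewrite -mulN1r -cintegralZ// -cintegralD//; last exact: cintegrableZ.
by congr cintegral; apply/funext => th; rewrite mulN1r.
Qed.

Lemma cintegrable_sum I (s : seq I) (F : I -> T -> R[i]) :
  (forall i, cintegrable (F i)) ->
  cintegrable (fun th => \sum_(i <- s) F i th).
Proof.
move=> iF; elim: s => [|i s ih].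
  under eq_fun do rewrite big_nil.
  by split; exact: finite_measure_integrable_cst.
by under eq_fun do rewrite big_cons; exact: cintegrableD.
Qed.

Lemma Rintegral_cstT (r : R) : \int[mu]_(th in setT) r = r.
Proof.
have muT : fine (mu setT) = 1.
  by rewrite (_ : mu setT = 1%E)//; exact: probability_setT.
by rewrite Rintegral_cst// muT mulr1.
Qed.

Lemma cintegral_cst z : cintegral mu (fun=> z) = z.
Proof.
by rewrite /cintegral !Rintegral_cstT; case: z.
Qed.

Lemma cintegral_sum I (s : seq I) (F : I -> T -> R[i]) :
  (forall i, cintegrable (F i)) ->
  cintegral mu (fun th => \sum_(i <- s) F i th) =
  \sum_(i <- s) cintegral mu (F i).
Proof.
move=> iF; elim: s => [|i s ih].
  by under eq_fun do rewrite big_nil; rewrite cintegral_cst big_nil.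
under eq_fun do rewrite big_cons.
by rewrite cintegralD ?ih ?big_cons//; exact: cintegrable_sum.
Qed.

Lemma cintegral_real (f : T -> R) :
  cintegral mu (fun th => (f th)%:C) = (\int[mu]_(th in setT) f th)%:C.
Proof. by rewrite /cintegral /= Rintegral_cst// mul0r. Qed.

Lemma ae_eq_cintegral F H : cmeasurable F -> cmeasurable H ->
  {ae mu, forall th, F th = H th} -> cintegral mu F = cintegral mu H.
Proof.
move=> [F1 F2] [H1 H2] FH; rewrite /cintegral /Rintegral; congr (fine _ +i* fine _).
  apply: ae_eq_integral => //; try exact/measurable_EFinP.
  by apply: filterS FH => th /= -> _.
apply: ae_eq_integral => //; try exact/measurable_EFinP.
by apply: filterS FH => th /= -> _.
Qed.

Definition square_integrable F :=
  cmeasurable F /\ mu.-integrable setT (fun th => (n2 (F th))%:E).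

(** The square of the L^2 norm as a real number. [Rintegral] sends an infinite integral to 0, so
    this is meaningful on [square_integrable] functions; [sqr_L2normE] goes back to the
    extended-real integral. *)
Definition sqr_L2norm F : R := \int[mu]_(th in setT) n2 (F th).

Lemma sqr_L2norm_ge0 F : 0 <= sqr_L2norm F.
Proof. by apply: Rintegral_ge0 => th _; exact: sqr_normc_ge0. Qed.

Lemma sqr_L2normE F : square_integrable F ->
  (\int[mu]_(th in setT) (n2 (F th))%:E = (sqr_L2norm F)%:E)%E.
Proof. by move=> [mF iF]; rewrite fineK//; exact: integrable_fin_num. Qed.

Lemma square_integrableP F : cmeasurable F ->
  (\int[mu]_(th in setT) (n2 (F th))%:E < +oo)%E -> square_integrable F.
Proof.
move=> mF iF; split=> //; apply/integrableP; split.
  by apply/measurable_EFinP; exact: measurable_sqr_normc.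
rewrite (eq_integral (fun th => (n2 (F th))%:E))// => th _.
by rewrite abse_EFin ger0_norm// sqr_normc_ge0.
Qed.

Lemma square_integrable_le (g : T -> R) F : cmeasurable F ->
  mu.-integrable setT (EFin \o g) -> (forall th, n2 (F th) <= g th) ->
  square_integrable F.
Proof.
move=> mF ig le; split=> //; apply: le_integrable ig => //.
  by apply/measurable_EFinP; exact: measurable_sqr_normc.
move=> th _ /=; rewrite lee_fin ger0_norm ?sqr_normc_ge0//.
by rewrite (le_trans (le th))// ler_norm.
Qed.

Lemma square_integrable_bounded F (M : R) : cmeasurable F ->
  (forall th, n2 (F th) <= M) -> square_integrable F.
Proof.
move=> mF le; apply: (@square_integrable_le (cst M)) => //.
exact: finite_measure_integrable_cst.
Qed.

Lemma square_integrableD F H : square_integrable F -> square_integrable H ->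
  square_integrable (fun th => F th + H th).
Proof.
move=> [mF iF] [mH iH].
apply: (square_integrable_le (cmeasurableD mF mH) (integrable_lin 2 2 iF iH)) => th.
exact: sqr_normcD_le.
Qed.

Lemma square_integrableM F H (M : R) : cmeasurable H ->
  (forall th, n2 (H th) <= M) -> square_integrable F ->
  square_integrable (fun th => H th * F th).
Proof.
move=> mH bH [mF iF].
apply: (square_integrable_le (cmeasurableM mH mF) (integrable_lin M 0 iF iF)) => th.
by rewrite sqr_normcM mul0r addr0; apply: ler_wpM2r => //; exact: sqr_normc_ge0.
Qed.

Lemma square_integrableZ z F : square_integrable F ->
  square_integrable (fun th => z * F th).
Proof.
by apply: (@square_integrableM _ _ (n2 z)) => //; exact: cmeasurable_cst.
Qed.

Lemma square_integrableB F H : square_integrable F -> square_integrable H ->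
  square_integrable (fun th => F th - H th).
Proof.
move=> sF sH; rewrite (_ : (fun _ => _) = (fun th => F th + (-1) * H th)).
  by apply: square_integrableD => //; exact: square_integrableZ.
by apply/funext => th; rewrite mulN1r.
Qed.

Lemma square_integrable_conj F : square_integrable F ->
  square_integrable (fun th => (F th)^*).
Proof.
move=> [mF iF]; split; first exact: cmeasurable_conj.
by under eq_fun do rewrite sqr_normc_conj.
Qed.

Lemma square_integrable_cst z : square_integrable (fun=> z).
Proof.
by apply: (@square_integrable_bounded _ (n2 z)) => //; exact: cmeasurable_cst.
Qed.

Lemma square_integrable_sum I (s : seq I) (F : I -> T -> R[i]) :
  (forall i, square_integrable (F i)) ->
  square_integrable (fun th => \sum_(i <- s) F i th).
Proof.
move=> iF; elim: s => [|i s ih].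
  under eq_fun do rewrite big_nil.
  exact: square_integrable_cst.
by under eq_fun do rewrite big_cons; exact: square_integrableD.
Qed.

(** The real and imaginary parts of the product are dominated by |F|^2 + |H|^2. *)
Lemma cintegrable_inner F H : square_integrable F -> square_integrable H ->
  cintegrable (fun th => F th * (H th)^*).
Proof.
move=> [mF iF] [mH iH].
have [m1 m2] := cmeasurableM mF (cmeasurable_conj mH).
split.
- apply: le_integrable (integrable_lin 1 1 iF iH) => //.
    exact/measurable_EFinP.
  move=> th _ /=; rewrite lee_fin !mul1r.
  rewrite [leRHS]ger0_norm ?addr_ge0 ?sqr_normc_ge0//.
  rewrite !sqr_normcE; case: (F th) (H th) => [a b] [c d] /=.
  rewrite ler_norml; apply/andP; split;
    have := sqr_ge0 (a - c); have := sqr_ge0 (b - d);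
    have := sqr_ge0 (a + c); have := sqr_ge0 (b + d); rewrite !expr2; nra.
- apply: le_integrable (integrable_lin 1 1 iF iH) => //.
    exact/measurable_EFinP.
  move=> th _ /=; rewrite lee_fin !mul1r.
  rewrite [leRHS]ger0_norm ?addr_ge0 ?sqr_normc_ge0//.
  rewrite !sqr_normcE; case: (F th) (H th) => [a b] [c d] /=.
  rewrite ler_norml; apply/andP; split;
    have := sqr_ge0 (a - d); have := sqr_ge0 (b - c);
    have := sqr_ge0 (a + d); have := sqr_ge0 (b + c); rewrite !expr2; nra.
Qed.

Lemma cintegrable_square_integrable F : square_integrable F -> cintegrable F.
Proof.
move=> sF; rewrite (_ : F = fun th => F th * (1 : R[i])^*).
  exact: cintegrable_inner sF (square_integrable_cst 1).
by apply/funext => th; rewrite conjC1 mulr1.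
Qed.

Lemma sqr_L2normB F H : square_integrable F -> square_integrable H ->
  sqr_L2norm (fun th => F th - H th) =
  sqr_L2norm F - 2 * complex.Re (cintegral mu (fun th => F th * (H th)^*))
    + sqr_L2norm H.
Proof.
move=> sF sH; have [_ iF] := sF; have [_ iH] := sH.
have [iR _] := cintegrable_inner sF sH.
rewrite /sqr_L2norm /cintegral [complex.Re (_ +i* _)]/=.
rewrite -mulNr -[X in X + _ + _]mul1r -[X in _ + X]mul1r.
rewrite -Rintegral_lin//  -[X in X + _]mul1r -Rintegral_lin//.
- by apply: eq_Rintegral => th _; rewrite sqr_normcB mulNr !mul1r.
- by apply: integrable_lin.
Qed.

Lemma sqr_L2normD_le F H : square_integrable F -> square_integrable H ->
  sqr_L2norm (fun th => F th + H th) <= 2 * sqr_L2norm F + 2 * sqr_L2norm H.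
Proof.
move=> sF sH; have [_ iF] := sF; have [_ iH] := sH.
rewrite /sqr_L2norm -Rintegral_lin//; apply: le_Rintegral => //.
- by have [] := square_integrableD sF sH.
- exact: integrable_lin.
- by move=> th _; exact: sqr_normcD_le.
Qed.

Lemma sqr_L2normZ z F : square_integrable F ->
  sqr_L2norm (fun th => z * F th) = n2 z * sqr_L2norm F.
Proof.
move=> [_ iF]; rewrite /sqr_L2norm -RintegralZl//.
by apply: eq_Rintegral => th _; rewrite sqr_normcM.
Qed.

(** With c the inner product, ||F - t c H||^2 >= 0 for all real t is a quadratic inequality in t
    ([key]), used at its minimum t = 1 / ||H||^2. *)
Lemma L2_Cauchy_Schwarz F H : square_integrable F -> square_integrable H ->
  n2 (cintegral mu (fun th => F th * (H th)^*)) <= sqr_L2norm F * sqr_L2norm H.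
Proof.
move=> sF sH; set c := cintegral mu _.
have key (t : R) :
    0 <= sqr_L2norm F - 2 * t * n2 c + t ^+ 2 * n2 c * sqr_L2norm H.
  have := sqr_L2norm_ge0 (fun th => F th - (t%:C * c) * H th).
  rewrite sqr_L2normB//; last exact: square_integrableZ.
  rewrite sqr_L2normZ// (_ : cintegral _ _ = (t%:C * c)^* * c); last first.
    rewrite -(cintegralZ ((t%:C * c)^*) (cintegrable_inner sF sH)).
    by congr (cintegral mu _); apply/funext => th; rewrite rmorphM; ring.
  by rewrite !sqr_normcE; case: c => [a b] /=; rewrite !expr2 => h; nra.
move: (n2 c) (sqr_normc_ge0 c) key => n n_ge0 key.
have [->|n0] := eqVneq n 0; first by rewrite mulr_ge0 ?sqr_L2norm_ge0.
have [H0|H0] := eqVneq (sqr_L2norm H) 0.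
  (* When ||H|| = 0 the quadratic is affine in t, and this t would give it the value -1. *)
  have := key ((sqr_L2norm F + 1) / (2 * n)).
  rewrite H0 !mulr0 addr0.
  have -> : 2 * ((sqr_L2norm F + 1) / (2 * n)) * n = sqr_L2norm F + 1 by field.
  lra.
have H1 : 0 < sqr_L2norm H by rewrite lt_def H0 sqr_L2norm_ge0.
have := key (sqr_L2norm H)^-1.
have -> : sqr_L2norm F - 2 * (sqr_L2norm H)^-1 * n +
  (sqr_L2norm H)^-1 ^+ 2 * n * sqr_L2norm H = sqr_L2norm F - n / sqr_L2norm H.
  by field.
by rewrite subr_ge0 ler_pdivrMr.
Qed.

Lemma sqr_L2norm_eq0 F : square_integrable F -> sqr_L2norm F = 0 ->
  {ae mu, forall th, F th = 0}.
Proof.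
move=> sF F0; have := sqr_L2normE sF; rewrite F0; have [mF _] := sF => int0.
have m2 : measurable_fun setT (fun th => (n2 (F th))%:E).
  by apply/measurable_EFinP; exact: measurable_sqr_normc.
have [+ _] := ae_eq_integral_abs mu measurableT m2.
rewrite (eq_integral (fun th => (n2 (F th))%:E)); last first.
  by move=> th _; rewrite abse_EFin ger0_norm// sqr_normc_ge0.
move=> /(_ int0); apply: filterS => th /= /(_ I) [] /eqP.
by rewrite sqrf_eq0 => /eqP /Normc.eq0_normc.
Qed.

End ComplexIntegral.

(** * Characters and trigonometric polynomials *)

Section DualTopology.
Context {R : realType} {G : zmodType}.
Local Notation T := (borel_dual R G).
Implicit Types (th : dual R G) (g h : G).

Lemma ev_continuous g : continuous (fun th : dual R G => ev th g : R[i]^o).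
Proof.
move=> th.
apply: (@continuous_comp (dual R G) {ptws G -> R[i]^o} R[i]^o
  set_val (@proj G (fun=> R[i]^o) g)).
  exact: initial_continuous.
exact: proj_continuous.
Qed.

Lemma Re_continuous : continuous (fun z : R[i]^o => complex.Re z).
Proof.
move=> z; apply/(@cvgrPdist_lt _ _ _ _ (nbhs_filter (z : R[i]^o))) => e e0.
apply/(@nbhs_normP _ R[i]^o); exists e%:C; first by rewrite /= ltcR.
move=> w /=.
rewrite -ltcR; apply: le_lt_trans; apply: le_trans (normc_ge_Re _).
by case: z w => [a b] [c d] /=.
Qed.

Lemma Im_continuous : continuous (fun z : R[i]^o => complex.Im z).
Proof.
move=> z; apply/(@cvgrPdist_lt _ _ _ _ (nbhs_filter (z : R[i]^o))) => e e0.
apply/(@nbhs_normP _ R[i]^o); exists e%:C; first by rewrite /= ltcR.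
move=> w /=.
rewrite -ltcR; apply: le_lt_trans.
(* Multiplication by the unimodular -i turns the imaginary part into a real part. *)
rewrite -[leRHS]mulr1 (_ : 1 = `|(- 'i%C : R[i])|); last first.
  by rewrite normrN normc_def /= expr0n expr1n add0r sqrtr1.
rewrite -normrM; apply: le_trans (normc_ge_Re _).
case: z w => [a b] [c d] /=.
by rewrite !(mulr0, mul0r, mulrN, mulr1, oppr0, add0r, opprK, sub0r).
Qed.

Lemma continuous_measurable (f : dual R G -> R) : continuous f ->
  measurable_fun setT (f : T -> R).
Proof.
move=> cf; apply: (measurability _ (RGenOInfty.measurableE R)) => //.
move=> /= _ [_ [a ->] <-]; rewrite setTI; apply: sub_sigma_algebra.
apply: open_comp; first by move=> th _; exact: cf.
exact: interval_open.
Qed.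

Lemma cmeasurable_ev g : cmeasurable (fun th : T => ev th g).
Proof.
split; apply: continuous_measurable => th.
- apply: (continuous_comp (f := fun th => ev th g : R[i]^o)
    (g := fun z : R[i]^o => complex.Re z)).
    exact: ev_continuous.
  exact: Re_continuous.
- apply: (continuous_comp (f := fun th => ev th g : R[i]^o)
    (g := fun z : R[i]^o => complex.Im z)).
    exact: ev_continuous.
  exact: Im_continuous.
Qed.

(** The dual has the initial topology of its inclusion into a product, so continuity is checked one
    coordinate g at a time, where the map is multiplication by the constant [ev th g]. *)
Lemma mul_character_continuous th : continuous (mul_character th).
Proof.
pose v : dual R G -> {ptws G -> R[i]^o} := set_val.
suff h : continuous (v \o mul_character th).
  exact: (@continuous_comp_initial (set_type characters) (dual R G)
    {ptws G -> R[i]^o} set_val (mul_character th) h).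
move=> th'.
have FF : Filter (v (mul_character th x) @[x --> th']).
  by apply: fmap_filter; exact: nbhs_filter.
apply/cvg_sup => g A /= [_ [[B Bop <-] Bth sBA]].
have cg : (ev th g : R[i]^o) * ev th'' g @[th'' --> th'] -->
    (ev th g * ev th' g : R[i]^o).
  by apply: (@cvgMl_tmp _ _ _ (nbhs_filter th')); exact: ev_continuous.
have cgB := cg B (open_nbhs_nbhs (conj Bop Bth)).
by apply: (@filterS _ _ (nbhs_filter th') _ _ _ cgB) => th'' Bth''; exact: sBA.
Qed.
End DualTopology.

Section Characters.
Context {R : realType} {G : zmodType}.
Implicit Types (th : dual R G) (g h : G).

Lemma ev0 th : ev th 0 = 1.
Proof.
have [n1 mD] := evP th; have := mD 0 0; rewrite addr0 => /eqP.
rewrite -subr_eq0 -{1}(mulr1 (ev th 0)) -mulrBr mulf_eq0 => /orP[/eqP e0|].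
  by have := n1 0; rewrite e0 normr0 => /eqP; rewrite eq_sym oner_eq0.
by rewrite subr_eq0 => /eqP.
Qed.

Lemma mul_conj_ev th g : (ev th g)^* * ev th g = 1.
Proof. by have [n1 _] := evP th; rewrite mulrC -normCK n1 expr1n. Qed.

Lemma evN th g : ev th (- g) = (ev th g)^*.
Proof.
have [n1 mD] := evP th.
by rewrite -[RHS]mulr1 -(ev0 th) -(subrr g) mD mulrA mul_conj_ev mul1r.
Qed.

Lemma sqr_normc_ev th g : n2 (ev th g) = 1.
Proof.
by apply: (@complexI R); rewrite -mul_conjcE mulrC mul_conj_ev.
Qed.

(** Uses the inverse character g |-> th (- g). Surjectivity reconciles the Haar hypothesis, stated
    with direct images, with change of variables, stated with preimages. *)
Lemma mul_character_surj th th' : exists th'', mul_character th th'' = th'.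
Proof.
have charV : characters (fun g => ev th (- g)).
  have [n1 mD] := evP th.
  by split=> [g|g h]; [exact: n1|rewrite opprD mD].
pose thV : dual R G := exist (fun f => f \in characters) _ (mem_set charV).
exists (mul_character thV th'); apply: val_inj; apply/funext => g /=.
change (ev th g * (ev th (- g) * ev th' g) = ev th' g).
by rewrite mulrA evN (mulrC (ev th g)) mul_conj_ev mul1r.
Qed.

End Characters.

(** * Orthogonality of characters and Fourier coefficients *)

Section Orthogonality.
Context {R : realType} {G : zmodType} (mu : probability (borel_dual R G) R).
Hypothesis mu_haar : is_normalized_haar mu.
Hypothesis separated :
  forall g : G, g != 0 -> exists th : dual R G, ev th g != 1.
Local Notation T := (borel_dual R G).
Implicit Types (F H : T -> R[i]) (f c : G -> R[i]) (s : seq G).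

Lemma integral_mul_character (th : dual R G) (phi : T -> R) :
  measurable_fun setT phi ->
  mu.-integrable setT (EFin \o (phi \o mul_character th)) ->
  \int[mu]_(x in setT) phi (mul_character th x) = \int[mu]_(x in setT) phi x.
Proof.
move=> mphi iphi.
pose m : T -> T := mul_character th.
have mm : measurable_fun setT m.
  apply: (measurability _ (erefl (@measurable _ T))) => //.
  move=> _ [B Bop <-]; rewrite setTI; apply: sub_sigma_algebra.
  by apply: open_comp => // x _; exact: mul_character_continuous.
congr fine.
have mEphi : measurable_fun setT (EFin \o phi) by apply/measurable_EFinP.
transitivity (\int[pushforward mu m]_(y in setT) (phi y)%:E)%E.
  by rewrite (integral_pushforward mm mEphi iphi).
apply: eq_measure_integral => B mB _.
have mB' : measurable (m @^-1` B) by rewrite -[X in measurable X]setTI; exact: mm.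
(* The Haar property is applied to the preimage of B, whose direct image is B by surjectivity. *)
rewrite /pushforward; transitivity (mu (m @` (m @^-1` B))).
  by apply/esym; exact: mu_haar.
congr (mu _); apply/seteqP; split=> [_ [y By <-]//|x Bx].
by have [y yx] := mul_character_surj th x; exists y; rewrite /m /= yx.
Qed.

Lemma square_integrable_ev g : square_integrable mu (fun th : T => ev th g).
Proof.
apply: (@square_integrable_bounded _ _ _ _ 1); first exact: cmeasurable_ev.
by move=> th; rewrite sqr_normc_ev.
Qed.

Lemma cintegrable_ev g : cintegrable mu (fun th : T => ev th g).
Proof. exact/cintegrable_square_integrable/square_integrable_ev. Qed.

(** If th0 g differs from 1, translating by th0 multiplies the integral by th0 g, while invariance
    leaves it unchanged; so it vanishes. *)
Lemma cintegral_ev g : cintegral mu (fun th : T => ev th g) = (g == 0)%:R.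
Proof.
have [->|g0] := eqVneq g 0.
  by under eq_fun do rewrite ev0; rewrite cintegral_cst.
have [th0 th0g] := separated g0.
have evM th : ev (mul_character th0 th) g = ev th0 g * ev th g by [].
have [m1 m2] := @cmeasurable_ev R G g.
have [i1 i2] := cintegrableZ (ev th0 g) (cintegrable_ev g).
suff : ev th0 g * cintegral mu (fun th : T => ev th g) =
    cintegral mu (fun th : T => ev th g).
  move=> /eqP; rewrite -subr_eq0 -{2}(mul1r (cintegral _ _)) -mulrBl mulf_eq0.
  by rewrite subr_eq0 (negbTE th0g) => /eqP.
rewrite -(cintegralZ _ (cintegrable_ev g)) /cintegral; congr (_ +i* _).
- exact: (integral_mul_character m1 i1).
- exact: (integral_mul_character m2 i2).
Qed.

Definition trig c s : T -> R[i] := fun th => \sum_(h <- s) c h * (ev th h)^*.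

(** Fourier inversion: the transform carries the conjugate character, so its inverse carries the
    character itself. *)
Definition coef F h : R[i] := cintegral mu (fun th => F th * ev th h).

Lemma cmeasurable_trig c s : cmeasurable (trig c s).
Proof.
apply: cmeasurable_sum => h; apply: cmeasurableM; first exact: cmeasurable_cst.
by apply: cmeasurable_conj; exact: cmeasurable_ev.
Qed.

Lemma square_integrable_conj_ev z g :
  square_integrable mu (fun th : T => z * (ev th g)^*).
Proof.
apply: square_integrableZ; apply: square_integrable_conj.
exact: square_integrable_ev.
Qed.

Lemma square_integrable_trig c s : square_integrable mu (trig c s).
Proof. by apply: square_integrable_sum => h; exact: square_integrable_conj_ev. Qed.

Lemma cintegrable_coef F h : square_integrable mu F ->
  cintegrable mu (fun th => F th * ev th h).
Proof.
move=> sF; rewrite (_ : (fun _ => _) = fun th => F th * ((ev th h)^*)^*).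
  apply: cintegrable_inner => //; apply: square_integrable_conj.
  exact: square_integrable_ev.
by apply/funext => th; rewrite conjCK.
Qed.

Lemma coefB F H h : square_integrable mu F -> square_integrable mu H ->
  coef (fun th => F th - H th) h = coef F h - coef H h.
Proof.
move=> sF sH; rewrite /coef -cintegralB; [|exact: cintegrable_coef..].
by congr (cintegral mu _); apply/funext => th; rewrite mulrBl.
Qed.

Lemma coef_trig c s k : uniq s -> coef (trig c s) k = if k \in s then c k else 0.
Proof.
move=> us; rewrite /coef (_ : (fun _ => _) =
    fun th : T => \sum_(h <- s) c h * ev th (k - h)); last first.
  apply/funext => th; rewrite mulr_suml; apply: eq_bigr => h _.
  by have [_ ->] := evP th; rewrite evN mulrAC mulrA.
rewrite cintegral_sum; last by move=> h; apply/cintegrableZ/cintegrable_ev.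
under eq_bigr do rewrite (cintegralZ _ (cintegrable_ev _)) cintegral_ev subr_eq0.
case: ifPn => ks.
  rewrite (bigD1_seq k)//= eqxx mulr1 big1 ?addr0// => h hk.
  by rewrite eq_sym (negbTE hk) mulr0.
rewrite big1_seq// => h /andP[_ hs].
by case: eqP => [kh|_]; rewrite ?mulr0//; rewrite kh hs in ks.
Qed.

(** Orthonormality and completion of the square, one frequency at a time. Bessel's inequality, best
    approximation and recovery of the coefficients are all read off from this identity. *)
Lemma sqr_L2normB_trig F c s : square_integrable mu F -> uniq s ->
  sqr_L2norm mu (fun th => F th - trig c s th) =
  sqr_L2norm mu F - \sum_(h <- s) n2 (coef F h)
    + \sum_(h <- s) n2 (coef F h - c h).
Proof.
move=> sF; elim: s => [_|h s ih]; last (rewrite cons_uniq => /andP[hs us]).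
  rewrite !big_nil subr0 addr0; congr sqr_L2norm; apply/funext => th.
  by rewrite /trig big_nil subr0.
have sFs := square_integrableB sF (square_integrable_trig c s).
transitivity (sqr_L2norm mu (fun th => (F th - trig c s th) - c h * (ev th h)^*)).
  congr sqr_L2norm; apply/funext => th.
  by rewrite /trig big_cons; ring.
rewrite sqr_L2normB//; last exact: square_integrable_conj_ev.
rewrite (ih us) !big_cons.
have -> : sqr_L2norm mu (fun th : T => c h * (ev th h)^*) = n2 (c h).
  rewrite /sqr_L2norm (_ : (fun _ => _) = fun=> n2 (c h)).
    have := cintegral_cst mu ((n2 (c h))%:C); rewrite cintegral_real.
    by move/complexI.
  by apply/funext => th; rewrite sqr_normcM sqr_normc_conj sqr_normc_ev mulr1.
(* In the cross term, subtracting [trig c s] does not change the coefficient at h, because h is not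
   in s. *)
have -> : cintegral mu (fun th : T =>
      (F th - trig c s th) * (c h * (ev th h)^*)^*) =
    (c h)^* * coef F h.
  have <- : coef (fun th => F th - trig c s th) h = coef F h.
    rewrite (coefB _ sF (square_integrable_trig c s)) coef_trig//.
    by rewrite (negbTE hs) subr0.
  rewrite -(cintegralZ _ (cintegrable_coef _ sFs)).
  by congr (cintegral mu _); apply/funext => th; rewrite rmorphM /= conjCK; ring.
rewrite [n2 (coef F h - c h)]sqr_normcB (mulrC (coef F h)); ring.
Qed.

End Orthogonality.

(** * Plancherel theorem *)

Lemma ler_sum_fsubset (R : realDomainType) (I : choiceType) (A B : {fset I})
    (F : I -> R) : (A `<=` B)%fset -> (forall i, 0 <= F i) ->
  \sum_(i <- A) F i <= \sum_(i <- B) F i.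
Proof.
move=> AB F0; rewrite [leRHS](big_fsetID _ (mem A))/=.
rewrite (_ : [fset x in B | x \in A]%fset = A).
  by rewrite lerDl; apply: sumr_ge0 => i _.
apply/fsetP => i; rewrite !inE /= andbC.
by case: (boolP (i \in A)) => //= /(fsubsetP AB).
Qed.

Section Plancherel.
Context {R : realType} {G : zmodType} (mu : probability (borel_dual R G) R).
Hypothesis mu_haar : is_normalized_haar mu.
Hypothesis separated :
  forall g : G, g != 0 -> exists th : dual R G, ev th g != 1.
Local Notation T := (borel_dual R G).
Local Notation coef := (coef mu).
Implicit Types (F H : T -> R[i]) (f c : G -> R[i]) (s : seq G).

Lemma is_plancherelP f F : is_plancherel mu f F <->
  square_integrable mu F /\
  forall e : R, 0 < e -> exists S0 : {fset G}, forall S : {fset G},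
    (S0 `<=` S)%fset -> sqr_L2norm mu (fun th => F th - trig f S th) < e.
Proof.
split=> [[mF cvF]|[sF cvF]].
  have sF : square_integrable mu F.
    have [S0 /(_ S0 (fsubset_refl _)) lt1] := cvF 1 ltr01.
    have sD : square_integrable mu (fun th => F th - trig f S0 th).
      apply: square_integrableP.
        by apply: cmeasurableB => //; exact: cmeasurable_trig.
      by apply: lt_trans lt1 _; rewrite ltry.
    rewrite (_ : F = fun th => (F th - trig f S0 th) + trig f S0 th).
      by apply: square_integrableD => //; exact: square_integrable_trig.
    by apply/funext => th; rewrite subrK.
  split=> // e e0; have [S0 ltS0] := cvF e e0; exists S0 => S /ltS0.
  have sD := square_integrableB sF (square_integrable_trig mu f S).
  by rewrite (sqr_L2normE sD) lte_fin.
split; first by case: sF.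
move=> e e0; have [S0 ltS0] := cvF e e0; exists S0 => S /ltS0.
have sD := square_integrableB sF (square_integrable_trig mu f S).
by rewrite (sqr_L2normE sD) lte_fin.
Qed.

Lemma sqr_L2normB_coef F s : square_integrable mu F -> uniq s ->
  sqr_L2norm mu (fun th => F th - trig (coef F) s th) =
  sqr_L2norm mu F - \sum_(h <- s) n2 (coef F h).
Proof.
move=> sF us; rewrite sqr_L2normB_trig// [X in _ + X]big1 ?addr0// => h _.
by rewrite subrr Normc.normc0 expr0n.
Qed.

Lemma Bessel_inequality F s : square_integrable mu F -> uniq s ->
  \sum_(h <- s) n2 (coef F h) <= sqr_L2norm mu F.
Proof.
by move=> sF us; rewrite -subr_ge0 -sqr_L2normB_coef//; exact: sqr_L2norm_ge0.
Qed.

(** Once S contains h, |coef F h - f h|^2 is one of the nonnegative terms of ||F - trig f S||^2,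
    which is arbitrarily small. *)
Lemma coef_plancherel f F : is_plancherel mu f F -> coef F = f.
Proof.
move=> /is_plancherelP[sF cvF]; apply/funext => h; apply/eqP.
rewrite -subr_eq0; apply/eqP/Normc.eq0_normc/eqP.
rewrite -sqrf_eq0 eq_le sqr_normc_ge0 andbT; apply/ler_addgt0Pr => e e0.
rewrite add0r; have [S0 ltS0] := cvF e e0.
have /ltS0/ltW : (S0 `<=` h |` S0)%fset by exact: fsubsetUr.
apply: le_trans; rewrite (sqr_L2normB_trig mu_haar separated _ sF (fset_uniq _)).
rewrite -(sqr_L2normB_coef sF (fset_uniq _)); apply: ler_wpDl.
  exact: sqr_L2norm_ge0.
rewrite (bigD1_seq h)//= ?fset_uniq//; last by rewrite !inE eqxx.
by rewrite lerDl; apply: sumr_ge0 => k _; exact: sqr_normc_ge0.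
Qed.

(** Best approximation: on a fixed finite set the coefficients of F do at least as well as any c,
    and enlarging the set only decreases the error. Some approximation for each e therefore gives
    convergence along all finite sets. *)
Lemma is_plancherel_coef F : square_integrable mu F ->
  (forall e : R, 0 < e -> exists c (S : {fset G}),
    sqr_L2norm mu (fun th => F th - trig c S th) < e) ->
  is_plancherel mu (coef F) F.
Proof.
move=> sF apx; apply/is_plancherelP; split=> // e e0.
have [c [S0 ltS0]] := apx e e0; exists S0 => S S0S.
apply: le_lt_trans ltS0; rewrite (sqr_L2normB_coef sF (fset_uniq _)).
rewrite (sqr_L2normB_trig mu_haar separated _ sF (fset_uniq _)).
apply: ler_wpDr; first by apply: sumr_ge0 => h _; exact: sqr_normc_ge0.
by rewrite lerD2l lerN2; apply: ler_sum_fsubset => // h; exact: sqr_normc_ge0.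
Qed.

Lemma Parseval f F : is_plancherel mu f F ->
  (\esum_(h in setT) (n2 (f h))%:E = (sqr_L2norm mu F)%:E)%E.
Proof.
move=> fF; have /is_plancherelP[sF cvF] := fF.
rewrite -(coef_plancherel fF); apply/eqP; rewrite eq_le; apply/andP; split.
  apply: ge_ereal_sup => _ [A [finA _] <-].
  by rewrite fsbig_finite// sumEFin lee_fin (Bessel_inequality sF (fset_uniq _)).
apply/lee_addgt0Pr => e e0; have [S0 /(_ S0 (fsubset_refl _))] := cvF e e0.
rewrite -{1}(coef_plancherel fF) (sqr_L2normB_coef sF (fset_uniq _)) => lte.
rewrite -leeBlDr//; apply: esum_ge; exists [set` S0].
  by split=> //; exact: finite_fset.
rewrite fsbig_finite//= set_fsetK sumEFin lee_fin; lra.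
Qed.

Lemma is_plancherel_ell2 f F : is_plancherel mu f F -> ell2 f.
Proof. by move=> fF; rewrite /ell2 (Parseval fF) ltry. Qed.

Lemma sqr_ell2_norm f F : is_plancherel mu f F ->
  (ell2_norm f) ^+ 2 = sqr_L2norm mu F.
Proof.
move=> fF; rewrite /ell2_norm (Parseval fF) /= sqr_sqrtr//.
exact: sqr_L2norm_ge0.
Qed.

Lemma is_plancherel_lin z f F g H : is_plancherel mu f F -> is_plancherel mu g H ->
  is_plancherel mu (fun h => f h + z * g h) (fun th => F th + z * H th).
Proof.
move=> /is_plancherelP[sF cvF] /is_plancherelP[sH cvH]; apply/is_plancherelP.
split; first by apply: square_integrableD => //; exact: square_integrableZ.
move=> e e0.
have [S1 lt1] := cvF (e / 4) ltac:(by rewrite divr_gt0).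
(* The added 1 keeps the next tolerance meaningful when z = 0. *)
have z0 : 0 < n2 z + 1 by rewrite ltr_wpDl// sqr_normc_ge0.
have [S2 lt2] := cvH (e / (4 * (n2 z + 1))) ltac:(by rewrite divr_gt0// mulr_gt0).
exists (S1 `|` S2)%fset => S; rewrite fsubUset => /andP[/lt1 {}lt1 /lt2 {}lt2].
have sF' := square_integrableB sF (square_integrable_trig mu f S).
have sH' := square_integrableB sH (square_integrable_trig mu g S).
rewrite (_ : (fun _ => _) = fun th : T =>
   (F th - trig f S th) + z * (H th - trig g S th)); last first.
  apply/funext => th; rewrite /trig [in LHS](eq_bigr (fun h => f h * (ev th h)^* +
    z * (g h * (ev th h)^*))); last by move=> h _; ring.
  by rewrite big_split/= -mulr_sumr; ring.
apply: le_lt_trans (sqr_L2normD_le sF' (square_integrableZ z sH')) _.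
rewrite sqr_L2normZ//.
have : (n2 z + 1) * sqr_L2norm mu (fun th => H th - trig g S th) < e / 4.
  have -> : e / 4 = (n2 z + 1) * (e / (4 * (n2 z + 1))).
    by field; rewrite gt_eqF.
  by rewrite ltr_pM2l.
have := sqr_L2norm_ge0 mu (fun th => H th - trig g S th).
lra.
Qed.

Lemma is_plancherel_uniq f F H : is_plancherel mu f F -> is_plancherel mu f H ->
  {ae mu, forall th, F th = H th}.
Proof.
move=> fF fH.
have /is_plancherelP[sD cvD] := is_plancherel_lin (-1) fF fH.
suff D0 : sqr_L2norm mu (fun th => F th + -1 * H th) = 0.
  apply: filterS (sqr_L2norm_eq0 sD D0) => th /eqP.
  by rewrite mulN1r subr_eq0 => /eqP.
apply/eqP; rewrite eq_le sqr_L2norm_ge0 andbT; apply/ler_addgt0Pr => e e0.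
rewrite add0r; have [S /(_ S (fsubset_refl _)) /ltW] := cvD e e0.
apply: le_trans; rewrite (_ : (fun _ => _ - _) = fun th : T => F th + -1 * H th)//.
apply/funext => th; rewrite /trig big1 ?subr0// => h _.
by rewrite mulN1r subrr mul0r.
Qed.

End Plancherel.

(** The integrals of the phi n have a finite sum, so the sum of the phi n is finite almost
    everywhere; there the increments of u are absolutely summable and u converges. *)
Lemma ae_cvg_summable_increments d (T : measurableType d) (R : realType)
    (mu : {measure set T -> \bar R}) (u phi : nat -> T -> R) (a : R) :
  (forall n, measurable_fun setT (u n)) ->
  (forall n, measurable_fun setT (phi n)) ->
  (forall n x, `|u n.+1 x - u n x| <= phi n x) ->
  (forall n, \int[mu]_(x in setT) (phi n x)%:E <= (a / (2 ^ (n + 1))%:R)%:E)%E ->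
  exists2 g : T -> R, measurable_fun setT g &
    {ae mu, forall x, u n x @[n --> \oo] --> g x}.
Proof.
move=> mu_ mphi uphi iphi.
have phi0 n x : (0 <= (phi n x)%:E)%E by rewrite lee_fin (le_trans _ (uphi n x)).
have mEphi n : measurable_fun setT (fun x => (phi n x)%:E) by exact/measurable_EFinP.
pose Phi x : \bar R := (\sum_(n <oo) (phi n x)%:E)%E.
have iPhi : mu.-integrable setT Phi.
  apply/integrableP; split.
    by apply: ge0_emeasurable_sum.
  under eq_integral do rewrite gee0_abs ?nneseries_ge0//.
  rewrite integral_nneseries//.
  apply: (@le_lt_trans _ _ (\sum_(n <oo) ((a / (2 ^ (n + 1))%:R)%:E))%E).
    apply: lee_nneseries => // n _ _; exact: integral_ge0.
  by rewrite (cvg_lim _ (@cvg_geometric_eseries_half R a 0))// ltry.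
(* The upper limit is measurable everywhere and equals the limit wherever u converges. *)
exists (fun x => fine (limn_esup (fun n => (u n x)%:E))).
  apply: (measurableT_comp (fine_measurable measurableT)).
  by apply: measurable_fun_limn_esup => n; exact/measurable_EFinP.
apply: filterS (integrable_ae measurableT iPhi) => x /(_ I) finx.
suff /cvg_ex[l ul] : cvgn (fun n => u n x).
  have Eul : (u n x)%:E @[n --> \oo] --> l%:E by apply: cvg_EFin => //; exact: nearW.
  by have [_ ->] := cvg_limn_einf_sup Eul.
have cphi : cvgn (series (fun n => phi n x)).
  apply: nondecreasing_is_cvgn.
    by apply: nondecreasing_series => n _ _; rewrite -lee_fin.
  exists (fine (Phi x)) => _ [n _ <-]; rewrite -lee_fin fineK//.
  by rewrite seriesEnat /= -sumEFin; exact: nneseries_lim_ge.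
have ct : cvgn (series (telescope (fun n => u n x))).
  apply: normed_cvg; apply: series_le_cvg cphi => n //=; first by rewrite -lee_fin.
  exact: uphi.
rewrite (_ : (fun n => u n x) =
    fun n => u 0%N x + series (telescope (fun n => u n x)) n).
  exact: is_cvgD (is_cvg_cst _) ct.
by apply/funext => n; rewrite -eq_sum_telescope.
Qed.

Lemma limn_einf_le (R : realType) (u : (\bar R)^nat) (c : \bar R) (m : nat) :
  (forall n, (m <= n)%N -> u n <= c)%E -> (limn_einf u <= c)%E.
Proof.
move=> uc; rewrite limn_einf_lim; apply: lime_le; first exact: is_cvg_einfs.
exists m => //= n /= mn; apply: le_trans (uc n mn).
by apply: ereal_inf_lbound; exists n => /=.
Qed.

Lemma limn_einf_ge0 (R : realType) (u : (\bar R)^nat) :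
  (forall n, 0 <= u n)%E -> (0 <= limn_einf u)%E.
Proof.
move=> u0; rewrite limn_einf_lim; apply: lime_ge; first exact: is_cvg_einfs.
by apply: nearW => n; apply: le_ereal_inf_tmp => _ [k _ <-].
Qed.

Lemma measurable_fun_limn_einf d (T : measurableType d) (R : realType)
    (D : set T) (f : (T -> \bar R)^nat) :
  (forall n, measurable_fun D (f n)) ->
  measurable_fun D (fun x => limn_einf (f ^~ x)).
Proof.
move=> mf; rewrite /limn_einf.
apply: (measurableT_comp (f := -%E)) => //.
apply: (@measurable_fun_limn_esup _ _ _ _ (fun n x => - f n x)%E) => n.
exact: (measurableT_comp (f := -%E)).
Qed.

(** * Completeness: every square-summable function has a Plancherel transform *)

Section RieszFischer.
Context {R : realType} {G : zmodType} (mu : probability (borel_dual R G) R).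
Hypothesis mu_haar : is_normalized_haar mu.
Hypothesis separated :
  forall g : G, g != 0 -> exists th : dual R G, ev th g != 1.
Local Notation T := (borel_dual R G).
Implicit Types (F H : T -> R[i]) (f c : G -> R[i]).

Lemma sqr_L2normB_trig_sub f (S S' : {fset G}) : (S `<=` S')%fset ->
  sqr_L2norm mu (fun th => trig f S' th - trig f S th) =
  \sum_(h <- S') n2 (f h) - \sum_(h <- S) n2 (f h).
Proof.
move=> SS'.
have sT := square_integrable_trig mu f S'.
have N0 : sqr_L2norm mu (fun=> 0 : R[i]) = 0.
  rewrite /sqr_L2norm Normc.normc0 expr0n /=.
  by rewrite Rintegral_cstT.
have coefS h : h \in S' -> coef mu (trig f S') h = f h.
  by move=> hS; rewrite coef_trig// ?fset_uniq// hS.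
have sum_coef (A : {fset G}) : (A `<=` S')%fset ->
    \sum_(h <- A) n2 (coef mu (trig f S') h) = \sum_(h <- A) n2 (f h).
  by move=> AS; apply: eq_big_seq => h /(fsubsetP AS)/coefS ->.
have sum0 (A : {fset G}) : (A `<=` S')%fset ->
    \sum_(h <- A) n2 (coef mu (trig f S') h - f h) = 0.
  move=> AS; apply: big1_seq => h /andP[_ /(fsubsetP AS)/coefS ->].
  by rewrite subrr Normc.normc0 expr0n.
have trigN : sqr_L2norm mu (trig f S') = \sum_(h <- S') n2 (f h).
  have := sqr_L2normB_trig mu_haar separated f sT (fset_uniq S').
  rewrite sum_coef// sum0// addr0 (_ : (fun _ => _ - _) = fun=> 0).
    by rewrite N0 => /esym/eqP; rewrite subr_eq0 => /eqP.
  by apply/funext => th; rewrite subrr.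
rewrite (sqr_L2normB_trig mu_haar separated f sT (fset_uniq _)).
by rewrite trigN sum_coef// sum0// addr0.
Qed.

Lemma trig_tail f (e : R) : ell2 f -> 0 < e -> exists S0 : {fset G},
  forall S S' : {fset G}, (S0 `<=` S)%fset -> (S `<=` S')%fset ->
  sqr_L2norm mu (fun th => trig f S' th - trig f S th) < e.
Proof.
move=> f2 e0; set E := (\esum_(h in setT) (n2 (f h))%:E)%E.
have E0 : (0 <= E)%E by apply: esum_ge0 => h _; rewrite lee_fin sqr_normc_ge0.
have finE : E \is a fin_num by rewrite ge0_fin_numE.
have sumE (S : {fset G}) : \sum_(h <- S) n2 (f h) <= fine E.
  rewrite -lee_fin fineK//; apply: esum_ge; exists [set` S].
    by split=> //; exact: finite_fset.
  by rewrite fsbig_finite//= set_fsetK sumEFin.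
have : (E - e%:E < E)%E by rewrite lteBlDr// lteDl// lte_fin.
move=> /ereal_sup_gt[_ [A [finA _] <-]].
rewrite fsbig_finite// sumEFin -(fineK finE) -EFinB lte_fin => ltA.
exists (fset_set A) => S S' AS SS'; rewrite sqr_L2normB_trig_sub//.
have := ler_sum_fsubset AS (fun h => sqr_normc_ge0 (f h)).
have := sumE S'; lra.
Qed.

(** Partial sums over nested finite sets with fast decaying tails converge almost everywhere, and
    Fatou's lemma passes the L^2 bounds to the limit. *)
Lemma Riesz_Fischer f : ell2 f -> exists F, is_plancherel mu f F.
Proof.
move=> f2; pose a (n : nat) : R := 1 / (2 ^ (n + 1))%:R.
have a0 n : 0 < a n by rewrite divr_gt0// ltr0n expn_gt0.
have /choice[S0 tailS0] : forall n : nat, exists S0 : {fset G},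
    forall S S' : {fset G}, (S0 `<=` S)%fset -> (S `<=` S')%fset ->
    sqr_L2norm mu (fun th => trig f S' th - trig f S th) < (a n) ^+ 2.
  by move=> n; apply: trig_tail => //; exact: exprn_gt0.
pose fix U n : {fset G} := if n is k.+1 then (U k `|` S0 k.+1)%fset else S0 0%N.
have S0U n : (S0 n `<=` U n)%fset by case: n => [|n] //=; exact: fsubsetUr.
have UU n : (U n `<=` U n.+1)%fset by exact: fsubsetUl.
have Umon m n : (m <= n)%N -> (U m `<=` U n)%fset.
  move=> /subnK <-; elim: (n - m)%N => // k ih.
  by rewrite addSn; apply: fsubset_trans ih (UU _).
have tail n S : (U n `<=` S)%fset ->
    sqr_L2norm mu (fun th => trig f S th - trig f (U n) th) < (a n) ^+ 2.
  exact: tailS0.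
pose t n : T -> R[i] := trig f (U n).
have st n : square_integrable mu (t n) by exact: square_integrable_trig.
have mt n := cmeasurable_trig f (U n).
(* The bound x <= a + x^2 / a converts the L^2 estimate a^2 on an increment into the summable L^1
   estimate 2 a. *)
pose phi n (th : T) : R := a n + n2 (t n.+1 th - t n th) / a n.
have sD n := square_integrableB (st n.+1) (st n).
have mphi n : measurable_fun setT (phi n).
  apply: measurable_funD => //; apply: measurable_funM => //.
  by apply: measurable_sqr_normc; case: (sD n).
have iphi n : (\int[mu]_(th in setT) (phi n th)%:E <= (2 / (2 ^ (n + 1))%:R)%:E)%E.
  have i1 : mu.-integrable setT (EFin \o (cst 1 : T -> R)).
    exact: finite_measure_integrable_cst.
  have [_ i2] := sD n.
  have phiE : phi n = fun th => a n * 1 + (a n)^-1 * n2 (t n.+1 th - t n th).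
    by apply/funext => th; rewrite /phi mulr1 mulrC.
  have -> : (\int[mu]_(th in setT) (phi n th)%:E =
      (a n + sqr_L2norm mu (fun th => t n.+1 th - t n th) / a n)%:E)%E.
    have i12 := integrable_lin (a n) (a n)^-1 i1 i2.
    rewrite phiE -(fineK (integrable_fin_num measurableT i12)).
    congr (_%:E); rewrite -[LHS]/(Rintegral _ _ _) Rintegral_lin// Rintegral_cstT.
    by rewrite mulr1 mulrC.
  rewrite lee_fin (_ : 2 / _ = a n + a n); last by rewrite /a; lra.
  by rewrite lerD2l ler_pdivrMr// -expr2; apply/ltW/tail.
have phi_ge n th : Normc.normc (t n.+1 th - t n th) <= phi n th.
  rewrite /phi; move: (Normc.normc _) => x.
  rewrite -(ler_pM2r (a0 n)) mulrDl divfK ?gt_eqF// !expr2.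
  have := sqr_ge0 (x - a n / 2); have := sqr_ge0 (a n); rewrite !expr2; nra.
have [g1 mg1 cvg1] : exists2 g : T -> R, measurable_fun setT g &
    {ae mu, forall th, complex.Re (t n th) @[n --> \oo] --> g th}.
  apply: (ae_cvg_summable_increments _ mphi _ iphi) => [n|n th]; first by case: (mt n).
  apply: le_trans (phi_ge n th); apply: le_trans (normr_Re_le _).
  by case: (t n.+1 th) (t n th) => [x y] [x' y'].
have [g2 mg2 cvg2] : exists2 g : T -> R, measurable_fun setT g &
    {ae mu, forall th, complex.Im (t n th) @[n --> \oo] --> g th}.
  apply: (ae_cvg_summable_increments _ mphi _ iphi) => [n|n th]; first by case: (mt n).
  apply: le_trans (phi_ge n th); apply: le_trans (normr_Im_le _).
  by case: (t n.+1 th) (t n th) => [x y] [x' y'].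
pose F th : R[i] := g1 th +i* g2 th.
have mF : cmeasurable F by [].
exists F; split=> // e e0.
have [m am] : exists m, 4 * (a m) ^+ 2 < e.
  exists (Num.truncn (4 / e)); set m := Num.truncn _.
  have lem : 4 / e < m.+1%:R by exact: truncnS_gt.
  have le2 : (m.+1%:R : R) <= (2 ^ (m + 1))%:R.
    by rewrite ler_nat addn1 ltnW// ltn_expl.
  have a1 : a m <= 1.
    by rewrite /a ler_pdivrMr ?ltr0n ?expn_gt0// mul1r ler1n expn_gt0.
  have : 4 * a m < e.
    rewrite /a mulrA mulr1 ltr_pdivrMr ?ltr0n ?expn_gt0//.
    by rewrite mulrC -ltr_pdivrMr//; apply: lt_le_trans lem le2.
  by have := a0 m; rewrite expr2; nra.
exists (U m) => S US; apply: (@le_lt_trans _ _ (4 * a m ^+ 2)%:E).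
  2: by rewrite lte_fin.
have mtS n : measurable_fun setT (fun th => (n2 (t n th - trig f S th))%:E).
  apply/measurable_EFinP.
  exact: (measurable_sqr_normc (cmeasurableB (mt n) (cmeasurable_trig f S))).
have mFS : measurable_fun setT (fun th => (n2 (F th - trig f S th))%:E).
  apply/measurable_EFinP.
  exact: (measurable_sqr_normc (cmeasurableB mF (cmeasurable_trig f S))).
rewrite (ge0_ae_eq_integral measurableT mFS (measurable_fun_limn_einf mtS)).
- have tS0 n th : setT th -> (0 <= (n2 (t n th - trig f S th))%:E)%E.
    by move=> _; rewrite lee_fin sqr_normc_ge0.
  apply: le_trans (fatou mu measurableT mtS tS0) _.
  apply: (@limn_einf_le _ _ _ m) => n mn.
  have sS := square_integrable_trig mu f S.
  rewrite (sqr_L2normE (square_integrableB (st n) sS)) lee_fin.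
  (* Both [U n] and S contain [U m], so both sums are within (a m)^2 of [t m] in squared norm; this
     is the origin of the factor 4. *)
  have -> : (fun th => t n th - trig f S th) =
      fun th => (t n th - t m th) + (-1) * (trig f S th - t m th).
    by apply/funext => th; ring.
  have s1 := square_integrableB (st n) (st m).
  have s2 := square_integrableB sS (st m).
  apply: le_trans (sqr_L2normD_le s1 (square_integrableZ (-1) s2)) _.
  rewrite sqr_L2normZ// sqr_normcN Normc.normc1 expr1n mul1r.
  have := tail m S US; have := tail m (U n) (Umon _ _ mn); rewrite -/(t n) -/(t m).
  lra.
- by move=> th _; rewrite lee_fin sqr_normc_ge0.
- by move=> th _; apply: limn_einf_ge0 => n; rewrite lee_fin sqr_normc_ge0.
(* Almost everywhere the integrand is the limit, hence the lower limit, of those along [t n]. *)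
- apply: filterS2 cvg1 cvg2 => th c1 c2 _.
  have cvgRe (z : R[i]) :
      complex.Re (t n th - z) @[n --> \oo] --> complex.Re (F th - z).
    rewrite [X in _ --> X](_ : _ = g1 th - complex.Re z); last by case: z.
    rewrite (_ : (fun _ => _) = fun n => complex.Re (t n th) - complex.Re z).
      exact: cvgB c1 (cvg_cst _).
    by apply/funext => n; case: (t n th) z => [x y] [x' y'].
  have cvgIm (z : R[i]) :
      complex.Im (t n th - z) @[n --> \oo] --> complex.Im (F th - z).
    rewrite [X in _ --> X](_ : _ = g2 th - complex.Im z); last by case: z.
    rewrite (_ : (fun _ => _) = fun n => complex.Im (t n th) - complex.Im z).
      exact: cvgB c2 (cvg_cst _).
    by apply/funext => n; case: (t n th) z => [x y] [x' y'].
  have cvgN : n2 (t n th - trig f S th) @[n --> \oo] --> n2 (F th - trig f S th).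
    rewrite sqr_normcE; under eq_fun do rewrite sqr_normcE !expr2.
    by apply: cvgD; apply: cvgM.
  apply/esym/(cvg_limn_einf_sup _).1.
  by apply: cvg_EFin => //; exact: nearW.
Qed.

End RieszFischer.

(** * Uniform limits of trigonometric polynomials *)

(** One finite set serves every g between 0 and u: what g has outside S is at most what u has
    there. *)
Lemma esum_tail (R : realType) (I : choiceType) (u : I -> R) (e : R) :
  (forall i, 0 <= u i) -> (\esum_(i in setT) (u i)%:E < +oo)%E -> 0 < e ->
  exists S : {fset I}, forall g : I -> R, (forall i, 0 <= g i <= u i) ->
    (\esum_(i in setT) (g i)%:E)%E \is a fin_num /\
    \sum_(i <- S) g i <= fine (\esum_(i in setT) (g i)%:E)%E
      <= \sum_(i <- S) g i + e.
Proof.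
move=> u0 uoo e0; set E := (\esum_(i in setT) (u i)%:E)%E in uoo.
have E0 : (0 <= E)%E by apply: esum_ge0 => i _; rewrite lee_fin.
have finE : E \is a fin_num by rewrite ge0_fin_numE.
have fset_le (v : I -> R) (S : {fset I}) :
    ((\sum_(i <- S) v i)%:E <= \esum_(i in setT) (v i)%:E)%E.
  apply: esum_ge; exists [set` S]; first by split=> //; exact: finite_fset.
  by rewrite fsbig_finite//= set_fsetK sumEFin.
have : (E - e%:E < E)%E by rewrite lteBlDr// lteDl// lte_fin.
move=> /ereal_sup_gt[_ [A [finA _] <-]].
rewrite fsbig_finite// sumEFin -(fineK finE) -EFinB lte_fin => ltA.
exists (fset_set A) => g gu.
have g0 i : 0 <= g i by case/andP: (gu i).
have lgu i : g i <= u i by case/andP: (gu i).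
have Eg0 : (0 <= \esum_(i in setT) (g i)%:E)%E.
  by apply: esum_ge0 => i _; rewrite lee_fin.
have leE : (\esum_(i in setT) (g i)%:E <= E)%E.
  by apply: le_esum => i _; rewrite lee_fin.
have fing : (\esum_(i in setT) (g i)%:E)%E \is a fin_num.
  by rewrite ge0_fin_numE// (le_lt_trans leE).
split=> //; apply/andP; split; first by rewrite -lee_fin fineK.
(* The mass of u splits into those of g and u - g; bounding the latter below by its part on S bounds
   the sum of g above. *)
have EgD : (\esum_(i in setT) (g i)%:E + \esum_(i in setT) (u i - g i)%:E = E)%E.
  rewrite -esumD; [|by move=> i _; rewrite lee_fin ?subr_ge0..].
  by apply: eq_esum => i _; rewrite -EFinD addrC subrK.
have := fset_le (fun i => u i - g i) (fset_set A).
rewrite sumrB; move: EgD; rewrite -(fineK fing).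
case: (\esum_(i in setT) (u i - g i)%:E)%E => [x| |] /= EgD.
- rewrite lee_fin => lex; move: ltA; rewrite -EgD /=; lra.
- by move: finE; rewrite -EgD.
- by move=> h; move: finE; rewrite -EgD.
Qed.

(** S depends on the majorant u alone, which later gives uniformity over characters. Positive and
    negative parts both have errors in [0, e], so their difference is still within e. *)
Lemma rsum_approx (R : realType) (I : choiceType) (u : I -> R) (e : R) :
  (forall i, 0 <= u i) -> (\esum_(i in setT) (u i)%:E < +oo)%E -> 0 < e ->
  exists S : {fset I}, forall f : I -> R, (forall i, `|f i| <= u i) ->
    `|rsum f - \sum_(i <- S) f i| <= e.
Proof.
move=> u0 uoo e0; have [S HS] := esum_tail u0 uoo e0; exists S => f fu.
have posE : ((EFin \o f)^\+)%E = fun i => (Num.max (f i) 0)%:E.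
  by apply/funext => i; rewrite funeposE /= -EFin_max.
have negE : ((EFin \o f)^\-)%E = fun i => (Num.max (- f i) 0)%:E.
  by apply/funext => i; rewrite funenegE /= -EFin_max.
have [i|fin1 /andP[l1 l2]] := HS (fun i => Num.max (f i) 0).
  by rewrite le_max lexx orbT ge_max u0 andbT (le_trans _ (fu i))// ler_norm.
have [i|fin2 /andP[l3 l4]] := HS (fun i => Num.max (- f i) 0).
  rewrite le_max lexx orbT ge_max u0 andbT (le_trans _ (fu i))//.
  by rewrite ler_normr lexx orbT.
have -> : \sum_(i <- S) f i =
    \sum_(i <- S) Num.max (f i) 0 - \sum_(i <- S) Num.max (- f i) 0.
  rewrite -sumrB; apply: eq_bigr => i _.
  by rewrite /Num.max; case: ltP => h1; case: ltP => h2; lra.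
rewrite /rsum posE negE fineB// ler_norml; apply/andP; split; lra.
Qed.

Section UniformTrig.
Context {R : realType} {G : zmodType}.
Local Notation T := (borel_dual R G).
Implicit Types (F H : T -> R[i]) (c : G -> R[i]).

(** The uniform closure of the trigonometric polynomials. It is stable under linear combinations and
    uniform limits, and its members are Plancherel transforms of their own coefficients
    ([uniform_trig_plancherel]). *)
Definition uniform_trig F := forall e : R, 0 < e -> exists c (S : {fset G}),
  forall th, Normc.normc (F th - trig c S th) <= e.

Lemma trig_widen c (S S' : {fset G}) th : (S `<=` S')%fset ->
  trig c S th = trig (fun h => if h \in S then c h else 0) S' th.
Proof.
move=> SS'; rewrite /trig -[in RHS](big_fset_incl _ SS'); last first.
  by move=> h _ /negbTE ->; rewrite mul0r.
by apply: eq_big_seq => h ->.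
Qed.

Lemma uniform_trig_lin z F H : uniform_trig F -> uniform_trig H ->
  uniform_trig (fun th => F th + z * H th).
Proof.
move=> uF uH e e0.
have z0 : 0 <= Normc.normc z by exact: normc_ge0.
have [c [S cS]] := uF (e / 2) ltac:(by rewrite divr_gt0).
have e'0 : 0 < e / (2 * (Normc.normc z + 1)).
  by rewrite divr_gt0// mulr_gt0// ltr_wpDl.
have [c' [S' cS']] := uH _ e'0.
exists (fun h => (if h \in S then c h else 0) + z * (if h \in S' then c' h else 0)).
exists (S `|` S')%fset => th.
have -> : F th + z * H th - trig (fun h => (if h \in S then c h else 0) +
    z * (if h \in S' then c' h else 0)) (S `|` S')%fset th =
  (F th - trig c S th) + z * (H th - trig c' S' th).
  rewrite (trig_widen c th (fsubsetUl S S')) (trig_widen c' th (fsubsetUr S S')).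
  rewrite /trig [in LHS](eq_bigr (fun h => (if h \in S then c h else 0) * (ev th h)^* +
    z * ((if h \in S' then c' h else 0) * (ev th h)^*))); last first.
    by move=> h _; rewrite mulrDl mulrA.
  by rewrite big_split/= -mulr_sumr; ring.
apply: le_trans (le_normcD _ _) _; rewrite Normc.normcM.
have := cS th; have := cS' th.
rewrite ler_pdivlMr; last by rewrite mulr_gt0// ltr_wpDl.
have := normc_ge0 (H th - trig c' S' th).
nra.
Qed.

Lemma uniform_trig_cst z : uniform_trig (fun=> z).
Proof.
move=> e e0; exists (fun=> z), [fset 0]%fset => th.
by rewrite /trig big_seq_fset1 ev0 conjC1 mulr1 subrr Normc.normc0 ltW.
Qed.

Lemma uniform_trig_limit F :
  (forall e : R, 0 < e -> exists2 H, uniform_trig H &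
     forall th, Normc.normc (F th - H th) <= e) -> uniform_trig F.
Proof.
move=> apx e e0; have e2 : 0 < e / 2 by rewrite divr_gt0.
have [H uH FH] := apx _ e2; have [c [S cS]] := uH _ e2; exists c, S => th.
rewrite -(subrK (H th) (F th)) -addrA; apply: le_trans (le_normcD _ _) _.
by have := FH th; have := cS th; lra.
Qed.

Lemma uniform_trig_sum I (s : seq I) (z : I -> R[i]) (F : I -> T -> R[i]) :
  (forall i, uniform_trig (F i)) ->
  uniform_trig (fun th => \sum_(i <- s) z i * F i th).
Proof.
move=> uF; elim: s => [|i s ih].
  by under eq_fun do rewrite big_nil; exact: uniform_trig_cst.
under eq_fun do rewrite big_cons addrC.
exact: uniform_trig_lin.
Qed.

Lemma uniform_trig_cmeasurable F : uniform_trig F -> cmeasurable F.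
Proof.
move=> uF.
have /choice[H HF] : forall n : nat, exists H, cmeasurable H /\
    forall th, Normc.normc (F th - H th) <= n.+1%:R^-1.
  move=> n; have [c [S cS]] := uF n.+1%:R^-1 ltac:(by rewrite invr_gt0).
  by exists (trig c S); split=> //; exact: cmeasurable_trig.
have cvg0 (v : R) (u : nat -> R) : (forall n, `|v - u n| <= n.+1%:R^-1) ->
    u n @[n --> \oo] --> v.
  move=> uv; apply/cvgrPdist_le => e e0; near=> n.
  apply: le_trans (uv n) _; apply/ltW; near: n.
  exact: (near_infty_natSinv_lt (PosNum e0)).
split.
- apply: (measurable_fun_cvg (fun n => (HF n).1.1)) => th _; apply: cvg0 => n.
  apply: le_trans ((HF n).2 th); apply: le_trans (normr_Re_le _).
  by case: (F th) (H n th) => [x y] [x' y'].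
- apply: (measurable_fun_cvg (fun n => (HF n).1.2)) => th _; apply: cvg0 => n.
  apply: le_trans ((HF n).2 th); apply: le_trans (normr_Im_le _).
  by case: (F th) (H n th) => [x y] [x' y'].
Unshelve. all: by end_near. Qed.

(** Characters are unimodular, so u dominates the terms of the series for all th at once and a
    single finite set from [rsum_approx] serves the whole dual. *)
Lemma uniform_trig_fourier1 (u : G -> R) : (forall h, 0 <= u h) ->
  (\esum_(h in setT) (u h)%:E < +oo)%E ->
  uniform_trig (fourier1 (fun h => (u h)%:C)).
Proof.
move=> u0 uoo e e0; have e2 : 0 < e / 2 by rewrite divr_gt0.
have [S HS] := rsum_approx u0 uoo e2.
exists (fun h => (u h)%:C), S => th.
pose z h : R[i] := (u h)%:C * (ev th h)^*.
have normcE h : Normc.normc (z h) = u h.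
  transitivity (Normc.normc ((u h)%:C * ev th (- h))); first by rewrite evN.
  rewrite Normc.normcM; have [n1 _] := evP th.
  rewrite (complexI (n1 (- h) : (Normc.normc _)%:C = 1%:C)) mulr1.
  by rewrite /= expr0n /= addr0 sqrtr_sqr ger0_norm.
have ReS : complex.Re (trig (fun h => (u h)%:C) S th) =
    \sum_(h <- S) complex.Re (z h).
  rewrite (big_morph (@complex.Re R) (id1 := 0) (op1 := +%R))//.
  by move=> [a b] [a' b'].
have ImS : complex.Im (trig (fun h => (u h)%:C) S th) =
    \sum_(h <- S) complex.Im (z h).
  rewrite (big_morph (@complex.Im R) (id1 := 0) (op1 := +%R))//.
  by move=> [a b] [a' b'].
have /HS eRe h : `|complex.Re (z h)| <= u h by rewrite -normcE normr_Re_le.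
have /HS eIm h : `|complex.Im (z h)| <= u h by rewrite -normcE normr_Im_le.
apply: le_trans (normc_le_ReIm _) _.
rewrite [X in X <= _](_ : _ =
    `|rsum (fun h => complex.Re (z h)) - \sum_(h <- S) complex.Re (z h)|
    + `|rsum (fun h => complex.Im (z h)) - \sum_(h <- S) complex.Im (z h)|).
  by lra.
by rewrite -ReS -ImS; case: (trig _ _ _).
Qed.

Lemma uniform_trig_plancherel (mu : probability (borel_dual R G) R) F :
  is_normalized_haar mu ->
  (forall g : G, g != 0 -> exists th : dual R G, ev th g != 1) ->
  uniform_trig F -> is_plancherel mu (coef mu F) F.
Proof.
move=> mu_haar sep uF; have mF := uniform_trig_cmeasurable uF.
have sD c (S : {fset G}) (e : R) :
    (forall th, Normc.normc (F th - trig c S th) <= e) ->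
    square_integrable mu (fun th => F th - trig c S th) /\
    sqr_L2norm mu (fun th => F th - trig c S th) <= e ^+ 2.
  move=> le.
  have mD := cmeasurableB mF (cmeasurable_trig c S).
  have le2 th : n2 (F th - trig c S th) <= e ^+ 2.
    by rewrite ler_sqr ?nnegrE ?normc_ge0// (le_trans _ (le th)) ?normc_ge0.
  have sD := square_integrable_bounded mu mD le2.
  split=> //; rewrite -(Rintegral_cstT mu (e ^+ 2)); apply: le_Rintegral => //.
  - by case: sD.
  - exact: finite_measure_integrable_cst.
apply: is_plancherel_coef => //.
  have [c [S cS]] := uF 1 ltr01; have [sD1 _] := sD _ _ _ cS.
  rewrite (_ : F = fun th => (F th - trig c S th) + trig c S th).
    by apply: square_integrableD => //; exact: square_integrable_trig.
  by apply/funext => th; rewrite subrK.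
(* The uniform error gets squared: the minimum m satisfies m^2 <= m <= e / 2 < e. *)
move=> e e0; have e1 : 0 < Num.min 1 (e / 2) by rewrite lt_min ltr01 divr_gt0.
have [c [S cS]] := uF _ e1; have [_ N] := sD _ _ _ cS; exists c, S.
apply: le_lt_trans N _; rewrite expr2.
have : Num.min 1 (e / 2) <= 1 by rewrite ge_min lexx.
have : Num.min 1 (e / 2) <= e / 2 by rewrite ge_min lexx orbT.
nra.
Qed.

End UniformTrig.

(* The sum is a Riemann sum, of mesh [e], of [\int_0^oo exp (- y t) dt = 1 / y].  *)
Lemma inv_expR_riemann_sum (R : realType) (s e : R) : 0 < s -> 0 < e ->
  exists N : nat, forall y, s <= y ->
    `|y^-1 - \sum_(k < N) e * expR (- (y * (k%:R * e)))| <= e.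
Proof.
move=> s0 e0.
(* N makes the truncated tail small: below, q^N <= 1 / (1 + s e N) <= s e. *)
have [N Ns] : exists N : nat, 1 <= s * e * (1 + s * e * N%:R).
  exists (Num.truncn (s * e * (s * e))^-1).+1.
  have se0 : 0 < s * e * (s * e) by rewrite !mulr_gt0.
  set m := (_.+1)%:R; have h : 1 <= s * e * (s * e) * m.
    by rewrite -ler_pdivrMl// mulr1; exact/ltW/truncnS_gt.
  apply: le_trans h _.
  rewrite (_ : s * e * (1 + s * e * m) = s * e + s * e * (s * e) * m); last by ring.
  by rewrite lerDr ltW// mulr_gt0.
exists N => y sy; have y0 : 0 < y by exact: lt_le_trans sy.
set A := \sum_(k < N) _; pose q := expR (- (y * e)).
(* A is e times a geometric sum of ratio q = exp (- y e), and 1 - y e <= q <= 1 / (1 + y e). *)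
have Aq : (1 - q) * A = e * (1 - q ^+ N).
  have -> : A = e * \sum_(k < N) q ^+ k.
    rewrite mulr_sumr; apply: eq_bigr => k _; congr (_ * _).
    by rewrite /q -expRM_natl; congr expR; ring.
  rewrite mulrCA; congr (_ * _).
  have := subrX1 q N; rewrite -opprB => h; rewrite -opprB mulNr -h; ring.
have q0 : 0 < q by exact: expR_gt0.
have q1 : 1 - y * e <= q by apply: le_trans (expR_ge1Dx _); rewrite lerD2l.
have q2 : q * (1 + y * e) <= 1.
  by rewrite /q expRN ler_pdivrMl ?expR_gt0// mulr1 expR_ge1Dx.
have ye0 : 0 < y * e by exact: mulr_gt0.
have qlt1 : q < 1 by nra.
have qN0 : 0 <= q ^+ N by exact/exprn_ge0/ltW.
have qN1 : q ^+ N <= 1 by apply: exprn_ile1; exact: ltW.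
have qNs : q ^+ N <= s * e.
  have : q ^+ N * (1 + s * e * N%:R) <= 1.
    rewrite /q -expRM_natl.
    apply: (@le_trans _ _ (expR (N%:R * - (y * e)) * expR (N%:R * (s * e)))).
      rewrite ler_pM2l ?expR_gt0//; apply: le_trans (expR_ge1Dx _).
      by rewrite lerD2l mulrC.
    rewrite -expRD -expR0 ler_expR -mulrDr mulr_ge0_le0//.
    by rewrite addrC subr_le0 ler_pM2r.
  have sN : 0 <= s * e * N%:R by rewrite !mulr_ge0// ltW.
  have : 0 < s * e by exact: mulr_gt0.
  nra.
have A0 : 0 <= A by apply: sumr_ge0 => k _; rewrite mulr_ge0 ?expR_ge0// ltW.
have yV : y * y^-1 = 1 by rewrite divff// gt_eqF.
have yV0 : 0 < y^-1 by rewrite invr_gt0.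
rewrite ler_distl; apply/andP; split.
(* Upper bound on the sum: A <= e / (1 - q) <= (1 + y e) / y = 1 / y + e. *)
- have : (1 - q) * A <= e by rewrite Aq; nra.
  have : y * e <= (1 - q) * (1 + y * e) by nra.
  move=> h1 h2.
  have : A * (y * e) <= e * (1 + y * e).
    apply: (@le_trans _ _ (A * ((1 - q) * (1 + y * e)))); first exact: ler_wpM2l.
    by rewrite mulrA (mulrC A); apply: ler_wpM2r => //; rewrite addr_ge0// ltW.
  move=> h; have Ay : A * y <= 1 + y * e.
    by rewrite -(ler_pM2l e0) (_ : e * (A * y) = A * (y * e))//; ring.
  have : A * y * y^-1 <= (1 + y * e) * y^-1 by rewrite ler_pM2r.
  by rewrite mulfK ?gt_eqF// mulrDl mul1r (mulrC y) mulfK ?gt_eqF//; lra.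
(* Lower bound: 1 - q <= y e gives y A >= 1 - q^N, and q^N / y <= s e / y <= e. *)
- have h : 1 - q ^+ N <= y * A.
    rewrite -(ler_pM2l e0) -Aq mulrA (mulrC e); apply: ler_wpM2r => //; lra.
  have : y^-1 * (1 - q ^+ N) <= y^-1 * (y * A) by rewrite ler_pM2l.
  rewrite mulrA (mulrC y^-1 y) yV mul1r mulrBr mulr1.
  have : y^-1 * q ^+ N <= e.
    by rewrite ler_pdivrMl//; apply: le_trans qNs _; rewrite ler_pM2r.
  lra.
Qed.

(** A nonzero element of a free abelian group has a nonzero coordinate, of absolute value n say, at
    some generator x. With w^n = -1, the character g |-> w^(coeff x g) takes the value -1 there,
    whichever the sign of the coordinate. *)
Lemma separating_character (R : realType) (K : choiceType)
    (B : set {freeg K}) (h : gen_group B) :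
  h != 0 -> exists th : dual R (gen_group B), ev th h != 1.
Proof.
move=> h0; have [x cx] : exists x, coeff x (val h) != 0.
  apply: contrapT => /forallNP all0; move/negP: h0; apply.
  rewrite -val_eqE; apply/freeg_eqP => x; rewrite [RHS]coeff0.
  by apply/eqP/negP => /negP; exact: all0.
pose n := `|coeff x (val h)|%N; have n0 : (0 < n)%N by rewrite absz_gt0.
pose w : R[i] := n.-root (-1).
have wn : w ^+ n = -1 by rewrite rootCK.
have w0 : w != 0.
  apply: contra_eq_neq wn => ->.
  by rewrite expr0n gtn_eqF// eq_sym oppr_eq0 oner_eq0.
have nw : `|w| = 1.
  by apply/eqP; rewrite -(pexpr_eq1 n0)// -normrX wn normrN1.
have charP : characters (fun g : gen_group B => w ^ (coeff x (val g)) : R[i]).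
  split=> [g|g g'].
    by case: (coeff _ _) => m; rewrite /exprz ?normfV normrX nw expr1n ?invr1.
  by rewrite (_ : val (g + g') = val g + val g')// coeffD expfzDr.
pose th : dual R (gen_group B) := exist (fun f => f \in characters) _ (mem_set charP).
exists th; have evE : ev th h = w ^ coeff x (val h) by [].
suff -> : ev th h = -1.
  by rewrite -subr_eq0 -opprD oppr_eq0 (_ : 1 + 1 = 2%:R)// pnatr_eq0.
rewrite evE.
have [cE|cE] : coeff x (val h) = n \/ coeff x (val h) = - n%:Z.
  by rewrite /n; case: (coeff x (val h)) => m; [left|right].
- by rewrite cE -exprnP.
- by rewrite cE -exprnN wn invrN1.
Qed.

(** * The resolvent and the Green function *)

Section Resolvent.
Context {R : realType} {G : zmodType} (mu : probability (borel_dual R G) R).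
Hypothesis mu_haar : is_normalized_haar mu.
Hypothesis separated :
  forall g : G, g != 0 -> exists th : dual R G, ev th g != 1.
Local Notation T := (borel_dual R G).
Variable lam : dual R G -> R.
Hypothesis lam_ge0 : forall th, 0 <= lam th.
Hypothesis lam_trig : forall t : R, 0 <= t ->
  uniform_trig (fun th : T => (expR (- (t * lam th)))%:C).
Variable s : R.
Hypothesis s_gt0 : 0 < s.
Implicit Types (f : G -> R[i]).

Lemma plancherel_spec f : ell2 f -> is_plancherel mu f (plancherel mu f).
Proof. by move=> /(Riesz_Fischer mu_haar separated); exact: xgetPex. Qed.

Lemma slam_gt0 th : 0 < s + lam th.
Proof. by rewrite ltr_wpDr. Qed.

Definition resolvent_symbol (th : T) : R[i] := ((s + lam th)^-1)%:C.

(** The Riemann sum error is uniform over y = s + lam >= s, and each term of the sum is a multiple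
    of some exp (- t lam). *)
Lemma uniform_trig_resolvent_symbol : uniform_trig resolvent_symbol.
Proof.
apply: uniform_trig_limit => e e0.
have [N HN] := inv_expR_riemann_sum s_gt0 e0.
exists (fun th => \sum_(k < N) (e * expR (- (s * (k%:R * e))))%:C *
    (expR (- (k%:R * e * lam th)))%:C).
  apply: uniform_trig_sum => k; apply: lam_trig.
  by rewrite mulr_ge0// ltW.
move=> th; have := HN (s + lam th); rewrite lerDl => /(_ (lam_ge0 th)).
congr (_ <= _); rewrite /resolvent_symbol.
under [in RHS]eq_bigr do rewrite -rmorphM /=.
rewrite -rmorph_sum -rmorphB /= expr0n /= addr0 sqrtr_sqr.
congr (`|_ - _|); apply: eq_bigr => k _.
rewrite -[RHS]mulrA -expRD; congr (_ * expR _); ring.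
Qed.

Lemma measurable_lam : measurable_fun setT (lam : T -> R).
Proof.
have [mRe _] := uniform_trig_cmeasurable (lam_trig ler01).
(* lam is recovered as minus the logarithm of the semigroup symbol at time 1. *)
rewrite (_ : (lam : T -> R) = fun th => - ln (complex.Re (expR (- (1 * lam th)))%:C)).
  by apply: measurableT_comp => //; apply: measurableT_comp => //;
    exact: measurable_ln.
by apply/funext => th /=; rewrite expRK mul1r opprK.
Qed.

Lemma is_plancherel_delta0 : is_plancherel mu (delta0 : G -> R[i]) (fun=> 1).
Proof.
have := uniform_trig_plancherel mu_haar separated
  (uniform_trig_cst (G := G) (1 : R[i])).
congr is_plancherel; apply/funext => h; rewrite /coef.
by under eq_fun do rewrite mul1r; rewrite cintegral_ev.
Qed.

(** The candidate for (s + L)^-1 delta_0, confirmed by [resolvent_delta0]. *)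
Definition green_function : G -> R[i] := coef mu resolvent_symbol.

Lemma is_plancherel_green : is_plancherel mu green_function resolvent_symbol.
Proof.
exact: uniform_trig_plancherel mu_haar separated uniform_trig_resolvent_symbol.
Qed.

(** The transform of delta_0 - s g is 1 - s / (s + lam) = lam / (s + lam). *)
Lemma generator_graph_green :
  generator_graph mu lam green_function
    (fun h => delta0 h + (- s)%:C * green_function h).
Proof.
have pg := is_plancherel_green.
have pv := is_plancherel_lin (- s)%:C is_plancherel_delta0 pg.
have eg := is_plancherel_ell2 mu_haar separated pg.
have ev := is_plancherel_ell2 mu_haar separated pv.
split=> //.
apply: filterS2 (is_plancherel_uniq (plancherel_spec eg) pg)
  (is_plancherel_uniq (plancherel_spec ev) pv) => th -> ->.
rewrite /resolvent_symbol -!rmorphM /= -[1]/((1 : R)%:C) -rmorphD /=; congr (_%:C).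
by field; rewrite gt_eqF ?slam_gt0.
Qed.

(** [resolvent] is a choice, so existence and uniqueness are both required. For any solution r, (s +
    lam) times its transform is 1 almost everywhere; the transform is then the symbol, and the
    coefficients agree. *)
Lemma resolvent_delta0 : resolvent mu lam s delta0 = green_function.
Proof.
rewrite /resolvent.
set P := (X in xget _ X).
have [v gv rv] : P (xget (fun=> 0) P).
  apply: xgetPex; exists green_function; eexists; first exact: generator_graph_green.
  by move=> h /=; rewrite rmorphN mulNr addrCA subrr addr0.
move: gv rv; move: (xget _ _) => r [er ev Vr] rv.
have pr := plancherel_spec er; have pv := plancherel_spec ev.
have := is_plancherel_lin s%:C pv pr.
rewrite (_ : (fun h => v h + s%:C * r h) = delta0); last first.
  by apply/funext => h; rewrite addrC rv.
move=> /is_plancherel_uniq /(_ is_plancherel_delta0) V1.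
rewrite -(coef_plancherel mu_haar separated pr); apply/funext => h.
have [mP _] := pr; have [mF _] := is_plancherel_green.
apply: ae_eq_cintegral; [apply: cmeasurableM => //; exact: cmeasurable_ev..|].
apply: filterS2 Vr V1 => th -> V1; congr (_ * _).
have slam0 : (s + lam th)%:C != 0 :> R[i].
  by rewrite fmorph_eq0 gt_eqF ?slam_gt0.
rewrite /resolvent_symbol fmorphV; apply: (mulfI slam0).
by rewrite divff// rmorphD mulrDl addrC -V1 addrC.
Qed.

Definition green_value : R := \int[mu]_(th in setT) (s + lam th)^-1.

Lemma green_function0 : green_function 0 = green_value%:C.
Proof.
rewrite /green_function /coef -cintegral_real; congr cintegral.
by apply/funext => th; rewrite ev0 mulr1.
Qed.

Lemma csum_delta0 (z : G -> R[i]) : csum (fun h => delta0 h * z h) = z 0.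
Proof.
have rsum0 (x : G -> R) : (forall h, h != 0 -> x h = 0) -> rsum x = x 0.
  move=> x0.
  have esum0 (y : G -> \bar R) :
      (forall h : G, h != 0 -> y h = 0%E) -> (0%E <= y 0%R)%E ->
      \esum_(h in setT) y h = y 0.
    move=> y0 y00; rewrite -(esum_set1 y00) [RHS]esum_mkcond; apply: eq_esum => h _.
    by case: ifPn => //; rewrite in_set1 => /y0.
  rewrite /rsum !esum0 ?funeposE ?funenegE ?le_max ?lexx ?orbT//.
  - rewrite /= -!EFin_max /=.
    by rewrite /Num.max; case: ltP => h1; case: ltP => h2; lra.
  - by move=> h /x0; rewrite funenegE /= => ->; rewrite oppr0 maxxx.
  - by move=> h /x0; rewrite funeposE /= => ->; rewrite maxxx.
rewrite /csum !rsum0 /delta0 ?eqxx ?mul1r; first by case: (z 0).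
- by move=> h /negbTE ->; rewrite mul0r.
- by move=> h /negbTE ->; rewrite mul0r.
Qed.

Lemma green_eq : green mu lam s = green_value%:C.
Proof.
rewrite /green /ell2_inner resolvent_delta0 csum_delta0 green_function0.
by apply/eqP; rewrite eq_complex /= oppr0 !eqxx.
Qed.

Lemma sqr_normc_slam th z :
  n2 ((Num.sqrt (s + lam th))%:C * z) = (s + lam th) * n2 z.
Proof.
rewrite sqr_normcM; congr (_ * _); rewrite /= expr0n /= addr0 sqrtr_sqr.
by rewrite ger0_norm ?sqrtr_ge0// sqr_sqrtr// ltW// slam_gt0.
Qed.

Definition weighted_transform f (th : T) : R[i] :=
  (Num.sqrt (s + lam th))%:C * plancherel mu f th.

(** The conjugate is undone by the one in [L2_Cauchy_Schwarz], so the inner product with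
    [weighted_transform f] is the inversion integral for f h. *)
Definition weighted_character h (th : T) : R[i] :=
  (Num.sqrt (s + lam th))^-1%:C * (ev th h)^*.

Lemma measurable_slam : measurable_fun setT (fun th : T => s + lam th).
Proof. by apply: measurable_funD => //; exact: measurable_lam. Qed.

Lemma measurable_inv_slam : measurable_fun setT (fun th : T => (s + lam th)^-1).
Proof. by have [] := uniform_trig_cmeasurable uniform_trig_resolvent_symbol. Qed.

Lemma measurable_sqrt_slam :
  measurable_fun setT (fun th : T => Num.sqrt (s + lam th)).
Proof.
apply: measurableT_comp measurable_slam; apply: continuous_measurable_fun.
exact: sqrt_continuous.
Qed.

Lemma sqr_normc_weighted_character h th :
  n2 (weighted_character h th) = (s + lam th)^-1.
Proof.
have s0 : 0 < Num.sqrt (s + lam th) by rewrite sqrtr_gt0 slam_gt0.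
rewrite /weighted_character sqr_normcM sqr_normc_conj sqr_normc_ev mulr1.
rewrite /= expr0n /= addr0 sqrtr_sqr normfV ger0_norm ?ltW// exprVn.
by rewrite sqr_sqrtr// ltW// slam_gt0.
Qed.

Lemma square_integrable_weighted_character h :
  square_integrable mu (weighted_character h).
Proof.
apply: (@square_integrable_bounded _ _ _ _ s^-1) => [|th]; last first.
  by rewrite sqr_normc_weighted_character lef_pV2 ?posrE ?slam_gt0// lerDl.
apply: cmeasurableM; last by apply: cmeasurable_conj; exact: cmeasurable_ev.
apply: cmeasurable_real; under eq_fun do rewrite -sqrtrV ?ltW ?slam_gt0//.
apply: measurableT_comp measurable_inv_slam; apply: continuous_measurable_fun.
exact: sqrt_continuous.
Qed.

Lemma sqr_L2norm_weighted_character h :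
  sqr_L2norm mu (weighted_character h) = green_value.
Proof. by apply: eq_Rintegral => th _; exact: sqr_normc_weighted_character. Qed.

Lemma dirichlet_energy f : dirichlet_domain mu lam f ->
  square_integrable mu (weighted_transform f) /\
  (s * (ell2_norm f) ^+ 2)%:C + dirichlet_form mu lam f f =
  (sqr_L2norm mu (weighted_transform f))%:C.
Proof.
move=> [f2 Eoo]; have pf := plancherel_spec f2.
have /is_plancherelP[[mP iP] _] := pf.
have mlP : measurable_fun setT (fun th : T => lam th * n2 (plancherel mu f th)).
  by apply: measurable_funM; [exact: measurable_lam|exact: measurable_sqr_normc].
have iE : mu.-integrable setT
    (EFin \o (fun th : T => lam th * n2 (plancherel mu f th))).
  apply/integrableP; split; first exact/measurable_EFinP.
  rewrite (eq_integral (fun th : T =>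
    (lam th * n2 (plancherel mu f th))%:E))// => th _.
  by rewrite abse_EFin ger0_norm// mulr_ge0 ?sqr_normc_ge0.
have wE th : n2 (weighted_transform f th) =
    s * n2 (plancherel mu f th) + 1 * (lam th * n2 (plancherel mu f th)).
  by rewrite sqr_normc_slam mul1r mulrDl.
split.
  split; last by under eq_fun do rewrite wE; exact: integrable_lin.
  by apply: cmeasurableM => //; apply: cmeasurable_real; exact: measurable_sqrt_slam.
have -> : dirichlet_form mu lam f f =
    (\int[mu]_(th in setT) (lam th * n2 (plancherel mu f th)))%:C.
  rewrite -cintegral_real /dirichlet_form; congr cintegral; apply/funext => th.
  by rewrite -mulrA mul_conjcE -rmorphM.
rewrite (sqr_ell2_norm mu_haar separated pf) -rmorphD /=; congr (_%:C).
rewrite /sqr_L2norm -[X in _ + X]mul1r -Rintegral_lin//.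
by apply: eq_Rintegral => th _; rewrite wE.
Qed.

Lemma sqr_normc_le_green f h : dirichlet_domain mu lam f ->
  n2 (f h) <= green_value * sqr_L2norm mu (weighted_transform f).
Proof.
move=> df; have [sW _] := dirichlet_energy df.
rewrite mulrC -(sqr_L2norm_weighted_character h).
apply: le_trans (L2_Cauchy_Schwarz sW (square_integrable_weighted_character h)).
rewrite le_eqVlt; apply/orP; left; apply/eqP; congr (Normc.normc _ ^+ 2).
case: df => f2 _; rewrite -{1}(coef_plancherel mu_haar separated (plancherel_spec f2)).
congr cintegral; apply/funext => th.
rewrite /weighted_transform /weighted_character conj_realM mulrACA -rmorphM.
by rewrite divff ?mul1r// gt_eqF// sqrtr_gt0 slam_gt0.
Qed.

Lemma green_value_ge0 : 0 <= green_value.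
Proof. by apply: Rintegral_ge0 => th _; rewrite invr_ge0 ltW// slam_gt0. Qed.

(** A real [sup] is an upper bound only for a bounded set; the bound is the uniform estimate
    [sqr_normc_le_green]. *)
Lemma normc_le_sup_norm f h : dirichlet_domain mu lam f ->
  Normc.normc (f h) <= sup_norm f.
Proof.
move=> df; apply: ub_le_sup; last by exists h.
exists (Num.sqrt (green_value * sqr_L2norm mu (weighted_transform f))).
move=> _ [k _ <-]; rewrite -[leLHS]ger0_norm ?normc_ge0// -sqrtr_sqr.
by rewrite ler_sqrt ?sqr_normc_le_green// mulr_ge0 ?green_value_ge0 ?sqr_L2norm_ge0.
Qed.

Lemma sqr_sup_norm_le f : dirichlet_domain mu lam f ->
  (sup_norm f) ^+ 2 <= green_value * sqr_L2norm mu (weighted_transform f).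
Proof.
move=> df; have Q0 : 0 <= green_value * sqr_L2norm mu (weighted_transform f).
  by rewrite mulr_ge0 ?green_value_ge0 ?sqr_L2norm_ge0.
have sup0 : 0 <= sup_norm f.
  exact: le_trans (normc_ge0 (f 0)) (normc_le_sup_norm 0 df).
rewrite -[leRHS](sqr_sqrtr Q0) ler_sqr ?nnegrE ?sqrtr_ge0//.
apply: ge_sup => [|_ [k _ <-]]; first by exists (Normc.normc (f 0)), 0.
rewrite -[leLHS]ger0_norm ?normc_ge0// -sqrtr_sqr ler_sqrt//.
exact: sqr_normc_le_green.
Qed.

(** Otherwise the weighted character would vanish almost everywhere, although its squared modulus 1
    / (s + lam) is positive and the total mass is 1. *)
Lemma green_value_gt0 : 0 < green_value.
Proof.
rewrite lt_def green_value_ge0 andbT; apply/eqP => G0.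
have := sqr_L2norm_eq0 (square_integrable_weighted_character 0).
rewrite sqr_L2norm_weighted_character => /(_ G0) w0.
have : cintegral mu (fun=> 1) = cintegral mu (fun=> 0).
  apply: ae_eq_cintegral; [exact: cmeasurable_cst..|].
  apply: filterS w0 => th w0; exfalso.
  have := sqr_normc_weighted_character 0 th.
  rewrite w0 Normc.normc0 expr0n /= => /esym/eqP.
  by rewrite invr_eq0 gt_eqF// slam_gt0.
by rewrite !cintegral_cst => /eqP; rewrite oner_eq0.
Qed.

(** With transform 1 / (s + lam), the energy density (s + lam) / (s + lam)^2 is 1 / (s + lam)
    again. *)
Lemma green_extremal : dirichlet_domain mu lam green_function /\
  sqr_L2norm mu (weighted_transform green_function) = green_value.
Proof.
have pg := is_plancherel_green.
have eg := is_plancherel_ell2 mu_haar separated pg.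
have /is_plancherelP[[mP _] _] := plancherel_spec eg.
have /is_plancherelP[[mF _] _] := pg.
have PF := is_plancherel_uniq (plancherel_spec eg) pg.
have n2F th : n2 (resolvent_symbol th) = (s + lam th)^-1 ^+ 2.
  by rewrite /resolvent_symbol /= expr0n /= addr0 sqr_sqrtr// sqr_ge0.
have ae_int (w : T -> R) : measurable_fun setT w -> (forall th, 0 <= w th) ->
  (\int[mu]_(th in setT) (w th * n2 (plancherel mu green_function th))%:E =
   \int[mu]_(th in setT) (w th * (s + lam th)^-1 ^+ 2)%:E)%E.
  move=> mw w0; under [RHS]eq_integral do rewrite -n2F.
  apply: ge0_ae_eq_integral => //.
  - by apply/measurable_EFinP/measurable_funM => //; exact: measurable_sqr_normc.
  - by apply/measurable_EFinP/measurable_funM => //; exact: measurable_sqr_normc.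
  - by move=> th _; rewrite lee_fin mulr_ge0 ?sqr_normc_ge0.
  - by move=> th _; rewrite lee_fin mulr_ge0 ?sqr_normc_ge0.
  - by apply: filterS PF => th -> _.
have dg : dirichlet_domain mu lam green_function.
  split=> //; rewrite ae_int//; last exact: measurable_lam.
  (* The energy is finite because lam / (s + lam)^2 <= 1 / s. *)
  apply: (@le_lt_trans _ _ (\int[mu]_(th in setT) (s^-1)%:E)%E).
    apply: ge0_le_integral => //.
    - by move=> th _; rewrite lee_fin mulr_ge0 ?sqr_ge0.
    - apply/measurable_EFinP/measurable_funM; first exact: measurable_lam.
      by apply: measurable_funX; exact: measurable_inv_slam.
    - move=> th _; rewrite lee_fin; have sl := slam_gt0 th.
      rewrite expr2 mulrA ler_pdivrMr// ; apply: (@le_trans _ _ 1).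
        by rewrite ler_pdivrMr// mul1r lerDr ltW.
      by rewrite ler_pdivlMl// mulr1 lerDl.
  by apply: integrable_lty => //; exact: finite_measure_integrable_cst.
split=> //.
rewrite /sqr_L2norm /green_value /Rintegral; congr fine.
under eq_integral do rewrite sqr_normc_slam.
rewrite (ae_int _ measurable_slam); last by move=> th; exact/ltW/slam_gt0.
apply: eq_integral => th _; congr (_%:E); field.
by rewrite gt_eqF// slam_gt0.
Qed.

Lemma green_optimal_constant :
  (forall f, dirichlet_domain mu lam f ->
     ((sup_norm f) ^+ 2)%:C <=
       green mu lam s *
         ((s * (ell2_norm f) ^+ 2)%:C + dirichlet_form mu lam f f)) /\
  (forall C : R,
     (forall f, dirichlet_domain mu lam f ->
        ((sup_norm f) ^+ 2)%:C <=
          C%:C * ((s * (ell2_norm f) ^+ 2)%:C + dirichlet_form mu lam f f)) ->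
     green mu lam s <= C%:C).
Proof.
rewrite green_eq; split=> [f df|C HC].
  have [_ ->] := dirichlet_energy df.
  by rewrite -rmorphM lecR; exact: sqr_sup_norm_le.
have [dg Qg] := green_extremal; have := HC _ dg.
have [_ ->] := dirichlet_energy dg; rewrite Qg -rmorphM !lecR => le.
(* It remains to see G^2 <= C G: the right side bounds the squared supremum of g, and the supremum
   is at least |g 0| = G. *)
rewrite -(ler_pM2r green_value_gt0); apply: le_trans le.
rewrite -expr2 ler_sqr ?nnegrE ?green_value_ge0//; last first.
  exact: le_trans (normc_ge0 _) (normc_le_sup_norm 0 dg).
apply: le_trans (normc_le_sup_norm 0 dg).
by rewrite green_function0 /= expr0n /= addr0 sqrtr_sqr ler_norm.
Qed.

End Resolvent.

(** * Application to the support group *)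

Lemma esum_support_group_le1 (R : realType) (G : zmodType) (p : R -> G -> R) (t : R) :
  is_prob (p t) ->
  (\esum_(h in setT) (p t (support_group_val (p := p) h))%:E <= 1)%E.
Proof.
move=> [p0 p1].
rewrite -(@esum_image _ _ _ setT (support_group_val (p := p))
  (fun g => (p t g)%:E)); last first.
  by move=> h h' _ _; exact: val_inj.
rewrite -p1 esum_mkcond; apply: le_esum => g _.
by case: ifP => // _; rewrite lee_fin.
Qed.

Theorem theorem20
  (R : realType) (X : metricType R) (A : set X) (psi : R -> R)
  (p : R -> KXA A -> R)
  (mu : probability (borel_dual R (support_group p)) R)
  (lam : dual R (support_group p) -> R)
  (A_neq0 : A !=set0)
  (A_discrete : uniformly_discrete A)
  (psi_ge0 : forall r : R, 0 <= r -> 0 <= psi r)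
  (psi0 : psi 0 = 0)
  (psi_summable :
    (\esum_(xy in @off_pairs R X A) (psi (off_d1bar xy.1 xy.2))%:E < +oo)%E)
  (p_semigroup : convolution_semigroup p)
  (p_fourier : forall (t : R) (th : dual R (KXA A)), 0 <= t ->
    fourier1 (fun g => (p t g)%:C) th = (expR (- (t * lambda_psi psi th)))%:C)
  (mu_haar : is_normalized_haar mu)
  (lam_ge0 : forall th, 0 <= lam th)
  (lam_fourier : forall (t : R) (th : dual R (support_group p)), 0 <= t ->
    fourier1 (fun h => (p t (support_group_val h))%:C) th =
      (expR (- (t * lam th)))%:C)
  (s : R) (s_gt0 : 0 < s) :
  (forall f : support_group p -> R[i], dirichlet_domain mu lam f ->
     ((sup_norm f) ^+ 2)%:C <=
       green mu lam s *
         ((s * (ell2_norm f) ^+ 2)%:C + dirichlet_form mu lam f f)) /\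
  (forall C : R,
     (forall f : support_group p -> R[i], dirichlet_domain mu lam f ->
        ((sup_norm f) ^+ 2)%:C <=
          C%:C * ((s * (ell2_norm f) ^+ 2)%:C + dirichlet_form mu lam f f)) ->
     green mu lam s <= C%:C).
Proof.
have [p_prob _ _] := p_semigroup.
(* Two conditions remain: separation of points, and exp (- t lam) being a uniform limit of
   trigonometric polynomials, as the Fourier series of the summable p t. *)
apply: green_optimal_constant => // [h h0|t t0]; first exact: separating_character.
pose pt (h : support_group p) := p t (support_group_val h).
have : uniform_trig (fourier1 (fun h => (pt h)%:C)).
  apply: uniform_trig_fourier1 => [h|]; first exact: (p_prob t t0).1.
  exact: le_lt_trans (esum_support_group_le1 (p_prob t t0)) (ltry _).
by congr uniform_trig; apply/funext => th; exact: lam_fourier.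
Qed.
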